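(* Let a real Lie group $G$ have a $C^\infty$ action on a manifold $M$. Assume the $G$-action on $M$ is component effective. Let $\ell\in\{1,2,3,\ldots\}$. Assume the (prolonged) $G$-action on $\mathcal F^\ell M$ is proper. Then the $G$-action on $\mathcal F^\ell M$ is free.
   Context: Manifolds are $C^\infty$ real manifolds (not assumed connected). Actions are left actions. $\mathcal F^kM$ denotes the $k$th order frame bundle of $M$: its points over $p\in M$ are the $k$-jets at $0$ of local diffeomorphisms $\varphi$ from a neighborhood of $0$ in $\mathbb R^{\dim M}$ to $M$ with $\varphi(0)=p$. A $C^\infty$ action of $G$ on $M$ induces (by differentiation, ''prolongation'') a $G$-action on $\mathcal F^kM$, $g\cdot j^k_0\varphi=j^k_0(g\circ\varphi)$. An action of a group $G$ on a topological space $X$ is component effective if, for every $g\in G\setminus\{1_G\}$ and every connected component $X^\circ$ of $X$, there exists $x\in X^\circ$ such that $gx\ne x$. Proper action has its usual meaning: $(g,x)\mapsto(gx,x):G\times X\to X\times X$ is a proper map. *)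

(* Defs.v *)
From HB Require Import structures.
From mathcomp Require Import all_boot all_order all_algebra.
From mathcomp Require Import all_classical all_reals all_analysis.

Set Implicit Arguments.
Unset Strict Implicit.
Unset Printing Implicit Defensive.

Import Order.TTheory GRing.Theory Num.Theory.
Import numFieldNormedType.Exports.

Local Open Scope classical_set_scope.
Local Open Scope ring_scope.
Local Open Scope quotient_scope.

Section Smooth.
Context {R : realType}.

(* [pderiv f [:: i1; ...; ir]] is the iterated partial derivative
   d_i1 (... (d_ir f)). *)
Definition pderiv (m : nat) (W : normedModType R) (f : 'rV[R]_m -> W)
    (w : seq 'I_m) : 'rV[R]_m -> W :=
  foldr (fun i g => 'D_(delta_mx 0 i) g) f w.

(* Only meant for an open [U]: derivatives at points of [U] use the values of
   [f] near these points. *)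
Definition Cinfty_on (m : nat) (W : normedModType R) (U : set 'rV[R]_m)
    (f : 'rV[R]_m -> W) : Prop :=
  forall (w : seq 'I_m) (x : 'rV[R]_m), U x ->
    {for x, continuous (pderiv f w)} /\
    forall i, derivable (pderiv f w) x (delta_mx 0 i).
End Smooth.

(* The values of [chart_fun] outside [chart_dom], and of [chart_inv] outside
   its image, are irrelevant. *)
Record chart (R : realType) (n : nat) (M : Type) := Chart {
  chart_dom : set M;
  chart_fun :> M -> 'rV[R]_n;
  chart_inv : 'rV[R]_n -> M
}.

Definition is_chart (R : realType) (n : nat) (M : topologicalType)
    (c : chart R n M) : Prop :=
  [/\ open (chart_dom c),
      open (c @` chart_dom c),
      forall x, chart_dom c x -> chart_inv c (c x) = x,
      forall x, chart_dom c x -> {for x, continuous c} &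
      forall v, (c @` chart_dom c) v -> {for v, continuous (chart_inv c)}].

HB.mixin Record isManifold (R : realType) (n : nat) M of Topological M := {
  atlas : set (chart R n M);
  atlas_chart : forall c, atlas c -> is_chart c;
  atlas_cover : forall x : M, exists2 c, atlas c & chart_dom c x;
  atlas_compatible : forall c d, atlas c -> atlas d ->
    Cinfty_on (c @` (chart_dom c `&` chart_dom d)) (d \o chart_inv c);
  manifold_hausdorff : hausdorff_space M;
  manifold_second_countable : @second_countable M
}.

#[short(type="manifoldType")]
HB.structure Definition Manifold (R : realType) (n : nat) :=
  {M of isManifold R n M & Topological M}.
Arguments atlas {R n} s.

Definition prod_chart (R : realType) (m n : nat) (M N : Type)
    (c : chart R m M) (d : chart R n N) : chart R (m + n) (M * N) :=
  Chart (chart_dom c `*` chart_dom d)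
    (fun x => row_mx (c x.1) (d x.2))
    (fun v => (chart_inv c (lsubmx v), chart_inv d (rsubmx v))).

Definition prod_atlas (R : realType) (m n : nat) (M N : Type)
    (A : set (chart R m M)) (B : set (chart R n N)) :
    set (chart R (m + n) (M * N)) :=
  [set prod_chart c d | c in A & d in B].

Definition euclid_atlas (R : realType) (n : nat) : set (chart R n 'rV[R]_n) :=
  [set Chart setT id id].
Arguments euclid_atlas : clear implicits.

(* C^infty maps on an open set [U], with respect to given atlases of the source
   and of the target. *)
Definition smooth_on (R : realType) (m n : nat) (M N : topologicalType)
    (A : set (chart R m M)) (B : set (chart R n N)) (U : set M)
    (f : M -> N) : Prop :=
  (forall x, U x -> {for x, continuous f}) /\
  forall c d, A c -> B d ->
    Cinfty_on (c @` (U `&` chart_dom c `&` f @^-1` chart_dom d))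
      (d \o f \o chart_inv c).

HB.mixin Record isLieGroup (R : realType) (n : nat) G
    of Group G & Manifold R n G := {
  mulg_smooth : smooth_on (prod_atlas (atlas G) (atlas G))
    (atlas G) setT (fun x : G * G => (x.1 * x.2)%g);
  invg_smooth : smooth_on (atlas G) (atlas G) setT
    (fun x : G => (x^-1)%g)
}.

#[short(type="lieGroupType")]
HB.structure Definition LieGroup (R : realType) (n : nat) :=
  {G of isLieGroup R n G & Group G & Manifold R n G}.

Record smooth_action (R : realType) (m n : nat) (G : lieGroupType R m)
    (M : manifoldType R n) := SmoothAction {
  act :> G -> M -> M;
  act1 : forall x, act 1%g x = x;
  actM : forall g h x, act (g * h)%g x = act g (act h x);
  act_smooth : smooth_on (prod_atlas (atlas G) (atlas M))
    (atlas M) setT (fun gx : G * M => act gx.1 gx.2)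
}.

Section Frames.
Context {R : realType} {n : nat} (M : manifoldType R n).

Definition local_diffeo0 (phi : 'rV[R]_n -> M) : Prop :=
  exists (U : set 'rV[R]_n) (psi : M -> 'rV[R]_n),
  [/\ open U /\ U 0, open (phi @` U),
    forall v, U v -> psi (phi v) = v,
    smooth_on (euclid_atlas R n) (atlas M) U phi &
    smooth_on (atlas M) (euclid_atlas R n) (phi @` U) psi].

Record local_frame := LocalFrame {
  frame_fun :> 'rV[R]_n -> M;
  _ : local_diffeo0 frame_fun
}.

HB.instance Definition _ := gen_eqMixin local_frame.
HB.instance Definition _ := gen_choiceMixin local_frame.

Definition same_jet (k : nat) (phi psi : 'rV[R]_n -> M) : Prop :=
  phi 0 = psi 0 /\
  forall c, atlas M c -> chart_dom c (phi 0) ->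
    forall w, (size w <= k)%N -> pderiv (c \o phi) w 0 = pderiv (c \o psi) w 0.

Definition same_jetb (k : nat) (phi psi : local_frame) : bool :=
  `[< same_jet k phi psi >].

Lemma same_jetb_equiv k : equiv_class_of (same_jetb k).
Proof.
split=> [phi|phi psi|psi phi chi].
- exact/asboolP.
- by apply/asboolP/asboolP => -[e h]; split=> // c Ac; rewrite -e => cd w sw;
    rewrite h// e.
- move=> /asboolP[e h] /asboolP[e' h']; apply/asboolP; split=> [|c Ac cd w sw].
    by rewrite e.
  by rewrite h// h'// -e.
Qed.

Canonical same_jet_equiv k := EquivRelPack (same_jetb_equiv k).
End Frames.

Definition frame_bundle (R : realType) (n : nat) (M : manifoldType R n)
  (k : nat) : Type := {eq_quot (same_jet_equiv M k)}.

Section FrameTopology.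
Context {R : realType} {n : nat} (M : manifoldType R n) (k : nat).
Local Notation FkM := (frame_bundle M k).

HB.instance Definition _ := Quotient.on FkM.
HB.instance Definition _ := Choice.on FkM.

Definition jet (phi : local_frame M) : FkM := \pi_FkM phi.

Definition frame_repr (j : FkM) : local_frame M := repr j.

(* The manifold topology of the frame bundle: a chart [c] of [M] induces the
   chart sending the jet of [phi], with [phi 0] in the domain of [c], to the
   tuple of all partial derivatives of order at most [k] of [c \o phi] at [0].
   These coordinates do not depend on the representative. *)
Definition frame_subbase : set (set FkM) :=
  [set A | exists c w (O : set 'rV[R]_n),
    [/\ atlas M c, (size w <= k)%N, open O &
      A = [set j | chart_dom c (frame_repr j 0) /\
                   O (pderiv (c \o frame_repr j) w 0)]]].

HB.instance Definition _ := isSubBaseTopological.Build FkM frame_subbase id.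
End FrameTopology.

Definition component_effective (G : groupType) (X : topologicalType)
    (a : G -> X -> X) : Prop :=
  forall g : G, g <> 1%g -> forall x0 : X,
    exists2 x, connected_component setT x0 x & a g x <> x.

Definition proper_map (X Y : topologicalType) (f : X -> Y) : Prop :=
  continuous f /\ forall K : set Y, compact K -> compact (f @^-1` K).

Definition proper_action (G X : topologicalType) (a : G -> X -> X) : Prop :=
  proper_map (fun gx : G * X => (a gx.1 gx.2, gx.2)).

Definition free_action (G : groupType) (X : Type) (a : G -> X -> X) : Prop :=
  forall g x, a g x = x -> g = 1%g.

Section Calculus.
Context {R : realType}.

Lemma MVT0 (f df : R -> R) (a : R) :
  (forall t : R, `|t| <= `|a| -> is_derive t 1 f (df t)) ->
  exists2 c, `|c| <= `|a| & f a - f 0 = df c * a.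
Proof.
move=> fd.
have fc (b c : R) : (forall t, t \in `[b, c]%R -> `|t| <= `|a|) ->
    {within `[b, c], continuous f}.
  by move=> bc; apply: derivable_within_continuous => t /bc /fd [].
case: (leP 0 a) => a0.
- have H t : t \in `[0, a]%R -> `|t| <= `|a|.
    by rewrite in_itv/= => /andP[t0 ta]; rewrite !ger0_norm.
  have [|c cI e] := @MVT_segment R f df _ _ a0 _ (fc _ _ H).
    by move=> t tI; apply: fd; apply: H; apply: subset_itv_oo_cc tI.
  by exists c; [exact: H|rewrite e subr0].
- have H t : t \in `[a, 0]%R -> `|t| <= `|a|.
    by rewrite in_itv/= => /andP[t0 ta]; rewrite !ler0_norm ?lerN2// ltW.
  have [|c cI e] := @MVT_segment R f df _ _ (ltW a0) _ (fc _ _ H).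
    by move=> t tI; apply: fd; apply: H; apply: subset_itv_oo_cc tI.
  exists c; first exact: H.
  by apply: (@oppr_inj R); rewrite opprB e sub0r mulrN.
Qed.

Lemma is_derive_line (V W : normedModType R) (f : V -> W) (z v : V) (t : R) :
  derivable f (t *: v + z) v ->
  is_derive (t : R) 1 (fun s : R => f (s *: v + z)) ('D_v f (t *: v + z)).
Proof.
move=> fd.
have E : (fun h : R => h^-1 *: (((fun s : R => f (s *: v + z)) \o shift t) (h *: 1)
      - f (t *: v + z))) =
    (fun h : R => h^-1 *: ((f \o shift (t *: v + z)) (h *: v) - f (t *: v + z))).
  by apply/funext => h /=; rewrite [_%:A]mulr1 scalerDl addrA.
by apply: DeriveDef; rewrite /derivable /derive E.
Qed.

Lemma continuous_partial_differentiable n (g : 'rV[R]_n -> R) y :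
  (forall i, \forall x \near y, derivable g x (delta_mx 0 i)) ->
  (forall i, {for y, continuous ('D_(delta_mx 0 i) g)}) ->
  differentiable g y.
Proof.
move=> gd gc.
pose L (h : 'rV[R]_n) : R := \sum_i h 0 i * 'D_(delta_mx 0 i) g y.
have Llin : linear L.
  move=> a u v; rewrite /L scaler_sumr -big_split/=; apply: eq_bigr => i _.
  by rewrite !mxE mulrDl -mulrA.
pose Lm := GRing.isLinear.Build _ _ _ _ _ Llin.
pose LL : {linear _ -> _} := HB.pack L Lm.
have Lc : continuous LL.
  apply: continuous_big => [|i _]; first exact: add_continuous.
  move=> u; apply: (@cvgM _ _ (nbhs u) _ (fun h : 'rV[R]_n => h 0 i)).
    exact: coord_continuous.
  exact: cvg_cst.
suff E : g \o shift y = cst (g y) + LL +o_ 0 id.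
  by apply/diff_locallyP; rewrite (diff_unique Lc E).
apply/eqaddoP => _/posnumP[e] /=.
have n0 : (0 : R) < n.+1%:R by rewrite ltr0n.
pose e' := e%:num / n.+1%:R.
have e'0 : 0 < e' by rewrite divr_gt0.
have : \forall x \near y, forall i, derivable g x (delta_mx 0 i) /\
    `|'D_(delta_mx 0 i) g y - 'D_(delta_mx 0 i) g x| <= e'.
  apply: (@filter_forall _ _ _ (nbhs y) _ _) => i; apply: filterI; first exact: gd.
  by have /cvgrPdist_le := gc i; apply.
move=> /nbhs_ballP[d /= d0 Hd].
near=> h.
have hd : `|h| < d.
  near: h; apply/nbhs_ballP; exists d => // h.
  by rewrite -ball_normE /ball_/= sub0r normrN.
have hle i : `|h 0 i| <= `|h|.
  rewrite [leRHS]/Num.Def.normr/= mx_normrE.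
  exact: (le_bigmax _ (fun ij => `|h ij.1 ij.2|) (0, i)).
pose H (j : nat) : 'rV[R]_n := \row_i (if (i < j)%N then h 0 i else 0).
have H0 : H 0%N = 0 by apply/rowP => i; rewrite !mxE.
have Hn : H n = h by apply/rowP => i; rewrite !mxE ltn_ord.
have HS (j : 'I_n) : H j.+1 = h 0 j *: delta_mx 0 j + H j.
  apply/rowP => i; rewrite !mxE eqxx/= ltnS leq_eqVlt.
  have [->|ij] := eqVneq i j; first by rewrite eqxx ltnn mulr1 addr0.
  have /negPf -> : (i != j :> nat) by [].
  by rewrite mulr0 add0r.
have near_j (j : 'I_n) (t : R) : `|t| <= `|h 0 j| ->
    ball y d (t *: delta_mx 0 j + (y + H j)).
  move=> tj; rewrite -ball_normE /ball_/= addrCA opprD addrA subrr sub0r normrN.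
  apply: le_lt_trans hd.
  rewrite [leLHS]/Num.Def.normr/= mx_normrE.
  apply/bigmax_leP; split => // -[i0 i] _ /=; rewrite ord1 {i0} !mxE eqxx/=.
  have [->|ij] := eqVneq i j.
    by rewrite ltnn mulr1 addr0 (le_trans tj).
  by rewrite mulr0 add0r; case: ifP => // _; rewrite normr0.
have step (j : 'I_n) : `|g (y + H j.+1) - g (y + H j)
     - h 0 j * 'D_(delta_mx 0 j) g y| <= e' * `|h|.
  have [|c cle Ec] := @MVT0 (fun s => g (s *: delta_mx 0 j + (y + H j)))
     (fun s => 'D_(delta_mx 0 j) g (s *: delta_mx 0 j + (y + H j))) (h 0 j).
    by move=> t tj; apply: is_derive_line; have [] := Hd _ (near_j _ _ tj) j.
  move: Ec; rewrite scale0r add0r addrCA -HS => ->.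
  rewrite [X in _ - X]mulrC -mulrBl normrM ler_pM//.
  by rewrite distrC; have [] := Hd _ (near_j _ _ cle) j.
rewrite -[X in `|X| <= _]/(g (h + y) - (g y + L h)).
have -> : g (h + y) - (g y + L h) = \sum_(j < n) (g (y + H j.+1) - g (y + H j)
     - h 0 j * 'D_(delta_mx 0 j) g y).
  rewrite sumrB -(big_mkord xpredT (fun j => g (y + H j.+1) - g (y + H j))).
  by rewrite telescope_sumr// Hn H0 addr0 [y + h]addrC opprD addrA.
rewrite (le_trans (ler_norm_sum _ _ _))//.
rewrite (le_trans (ler_sum _ (fun j _ => step j)))// sumr_const card_ord.
rewrite -mulrnAl ler_wpM2r// /e' -mulr_natr -mulrA ler_piMr//.
by rewrite mulrC ler_pdivrMr// mul1r ler_nat.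
Unshelve. all: by end_near. Qed.

End Calculus.

Section Ck.
Context {R : realType}.
Local Notation e_ i := (delta_mx 0 i).

Fixpoint Ck_on (m : nat) (W : normedModType R) (k : nat) (U : set 'rV[R]_m)
    (f : 'rV[R]_m -> W) : Prop :=
  (forall x, U x -> {for x, continuous f}) /\
  if k is k'.+1 then forall i, (forall x, U x -> derivable f x (e_ i)) /\
    Ck_on k' U ('D_(e_ i) f) else True.

Lemma pderiv_rcons m (W : normedModType R) (f : 'rV[R]_m -> W) w i :
  pderiv f (rcons w i) = pderiv ('D_(e_ i) f) w.
Proof. by rewrite /pderiv foldr_rcons. Qed.

Section Generic.
Context {m : nat} {W : normedModType R}.
Implicit Types (f g : 'rV[R]_m -> W) (U : set 'rV[R]_m).

Lemma Ck_cont k U f : Ck_on k U f -> forall x, U x -> {for x, continuous f}.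
Proof. by case: k => [|k] []. Qed.

Lemma Cinfty_onP U f : Cinfty_on U f <-> forall k, Ck_on k U f.
Proof.
split=> [Uf k|].
- elim: k f Uf => [|k IH] f Uf; (split; first by move=> x /(Uf [::])[]) => //.
  move=> i; split; first by move=> x /(Uf [::])[].
  by apply: IH => w; rewrite -pderiv_rcons; exact: Uf.
- move=> + w; elim/last_ind: w f => [|w i IH] f Uf x Ux.
    by have [+ df] := Uf 1; move=> /(_ x Ux) cf; split=> // i; exact: (df i).1.
  rewrite pderiv_rcons; apply: IH => // k.
  by have [_ /(_ i)[]] := Uf k.+1.
Qed.

Lemma Ck_onW k U f : Ck_on k.+1 U f -> Ck_on k U f.
Proof.
elim: k f => [|k IH] f; first by case.
by move=> [cf df]; split=> // i; have [? ?] := df i; split=> //; exact: IH.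
Qed.

Lemma Ck_on_sub k U V f : V `<=` U -> Ck_on k U f -> Ck_on k V f.
Proof.
move=> VU; elim: k f => [|k IH] f [cf df]; split=> //; try by move=> x /VU/cf.
by move=> i; have [? ?] := df i; split; [by move=> x /VU; auto|exact: IH].
Qed.

Lemma near_eq_continuous (T T' : topologicalType) (f g : T -> T') x :
  (\forall y \near x, f y = g y) ->
  {for x, continuous f} -> {for x, continuous g}.
Proof.
move=> fg cf; rewrite /prop_for /continuous_at -(nbhs_singleton fg).
exact: cvg_trans (near_eq_cvg fg) cf.
Qed.

Lemma Ck_on_ext k U f g : open U -> (forall x, U x -> f x = g x) ->
  Ck_on k U f -> Ck_on k U g.
Proof.
move=> oU; elim: k f g => [|k IH] f g fg.
  move=> [cf _]; split=> // x Ux; apply: near_eq_continuous (cf x Ux).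
  by apply: filterS (open_nbhs_nbhs (conj oU Ux)).
move=> [cf df].
have nfg x : U x -> \forall y \near x, f y = g y.
  by move=> Ux; apply: filterS (open_nbhs_nbhs (conj oU Ux)).
split; first by move=> x Ux; apply: near_eq_continuous (cf x Ux); exact: nfg.
move=> i; have [di ci] := df i; split=> [x Ux|].
  by apply: near_eq_derivable (di x Ux); exact: nfg.
by apply: IH ci => x Ux; apply: near_eq_derive; exact: nfg.
Qed.

Lemma Ck_on_cst k U (a : W) : Ck_on k U (cst a : 'rV[R]_m -> W).
Proof.
elim: k a => [|k IH] a; (split; first by move=> x _; exact: cst_continuous) => //.
move=> i; split; first by move=> x _; exact: derivable_cst.
have -> : 'D_(e_ i) (cst a) = cst 0 :> ('rV[R]_m -> W).
  by apply/funext => x; rewrite derive_cst.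
exact: IH.
Qed.

Lemma Ck_onD k U f g : open U -> Ck_on k U f -> Ck_on k U g ->
  Ck_on k U (f + g).
Proof.
move=> oU; elim: k f g => [|k IH] f g [cf df] [cg dg].
  by split=> // x Ux; apply: continuousD; [exact: cf|exact: cg].
split; first by move=> x Ux; apply: continuousD; [exact: cf|exact: cg].
move=> i; have [df1 df2] := df i; have [dg1 dg2] := dg i; split.
  by move=> x Ux; apply: derivableD; auto.
apply: (@Ck_on_ext k U ('D_(e_ i) f + 'D_(e_ i) g)) => //; last exact: IH.
by move=> x Ux; rewrite deriveD; auto.
Qed.

Lemma Ck_on_sum k U (I : Type) (r : seq I) (F : I -> 'rV[R]_m -> W) : open U ->
  (forall i, Ck_on k U (F i)) -> Ck_on k U (fun x => \sum_(i <- r) F i x).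
Proof.
move=> oU UF; elim: r => [|i r IH].
  apply: (@Ck_on_ext k U (cst 0)) => //; last exact: Ck_on_cst.
  by move=> x _; rewrite big_nil.
apply: (@Ck_on_ext k U (F i + (fun x => \sum_(j <- r) F j x))) => //.
  by move=> x _; rewrite big_cons.
exact: Ck_onD.
Qed.
End Generic.

Lemma Ck_onM m k U (f g : 'rV[R]_m -> R) : open U ->
  Ck_on k U f -> Ck_on k U g -> Ck_on k U (f * g).
Proof.
move=> oU; elim: k f g => [|k IH] f g [cf df] [cg dg].
  by split=> // x Ux; apply: continuousM; [exact: cf|exact: cg].
split; first by move=> x Ux; apply: continuousM; [exact: cf|exact: cg].
move=> i; have [df1 df2] := df i; have [dg1 dg2] := dg i; split.
  by move=> x Ux; apply: derivableM; auto.
apply: (@Ck_on_ext _ _ k U (f * 'D_(e_ i) g + g * 'D_(e_ i) f)) => //.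
  by move=> x Ux; rewrite deriveM; auto.
apply: Ck_onD => //; apply: IH => //.
  by apply: Ck_onW; split=> // j; exact: df.
by apply: Ck_onW; split=> // j; exact: dg.
Qed.

Lemma continuous_rowP (T : topologicalType) n (f : T -> 'rV[R]_n) x :
  {for x, continuous f} <-> forall j, {for x, continuous (fun y => f y 0 j)}.
Proof.
split=> [cf j|cf].
  apply: (@continuous_comp _ _ _ f (fun v : 'rV[R]_n => v 0 j)) => //.
  exact: coord_continuous.
apply/cvgrPdist_le => e e0.
have : \forall y \near x, forall j, `|f x 0 j - f y 0 j| <= e.
  apply: (@filter_forall _ _ _ (nbhs x) _ _) => j.
  by have /cvgrPdist_le := cf j; apply.
apply: filterS => y fxy; rewrite [leLHS]/Num.Def.normr/= mx_normrE.
apply/bigmax_leP; split; first exact: ltW.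
by move=> -[i0 j] _ /=; rewrite ord1 !mxE.
Qed.

Lemma Ck_on_rowP m n k U (f : 'rV[R]_m -> 'rV[R]_n) : open U ->
  Ck_on k U f <-> forall j, Ck_on k U (fun x => f x 0 j).
Proof.
move=> oU; elim: k f => [|k IH] f.
  split=> [[cf _] j|Uf]; split=> // x Ux; first by have /continuous_rowP := cf x Ux; apply.
  by apply/continuous_rowP => j; have [cf _] := Uf j; exact: cf.
split=> [[cf df] j|Uf].
- split=> [x Ux|i]; first by have /continuous_rowP := cf x Ux; apply.
  have [df1 df2] := df i; split=> [x Ux|].
    by have /derivable_mxP := df1 x Ux; exact.
  apply: (@Ck_on_ext _ _ k U (fun x => 'D_(e_ i) f x 0 j)) => //.
    by move=> x Ux; rewrite derive_mx ?mxE; auto.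
  by move: j; apply/(IH ('D_(e_ i) f)).
- split=> [x Ux|i]; first by apply/continuous_rowP => j; have [+ _] := Uf j; apply.
  have df x : U x -> derivable f x (e_ i).
    move=> Ux; apply/derivable_mxP => i0 j; rewrite ord1.
    by have [_ /(_ i)[+ _]] := Uf j; apply.
  split=> //; apply/IH => j.
  apply: (@Ck_on_ext _ _ k U ('D_(e_ i) (fun x => f x 0 j))) => //.
    by move=> x Ux; rewrite derive_mx ?mxE; auto.
  by have [_ /(_ i)[]] := Uf j.
Qed.

Lemma Ck_on_differentiable n k U (g : 'rV[R]_n -> R) y : open U -> U y ->
  Ck_on k.+1 U g -> differentiable g y.
Proof.
move=> oU Uy [cg dg]; apply: continuous_partial_differentiable => i.
  by apply: filterS (open_nbhs_nbhs (conj oU Uy)) => x Ux; exact: (dg i).1.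
exact: Ck_cont (dg i).2 _ Uy.
Qed.

Lemma diff_partial n (g : 'rV[R]_n -> R) y u : differentiable g y ->
  'd g y u = \sum_j u 0 j * 'D_(e_ j) g y.
Proof.
move=> dg; rewrite {1}[u]row_sum_delta linear_sum; apply: eq_bigr => j _.
by rewrite linearZ/= deriveE.
Qed.

Lemma is_derive_comp_diff m (V W : normedModType R) (f : 'rV[R]_m -> V)
    (g : V -> W) x v : derivable f x v -> differentiable g (f x) ->
  is_derive x v (g \o f) ('d g (f x) ('D_v f x)).
Proof.
move=> df dg; pose p (h : R) := f (h *: v + x).
have p0 : p 0 = f x by rewrite /p scale0r add0r.
have dp : differentiable p 0.
  by apply/(iffLR (derivable1_diffP _ _)); apply/(iffLR (derivable1P _ _ _)).
have dgp : differentiable g (p 0) by rewrite p0.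
have dc : differentiable (g \o p) 0 by exact: differentiable_comp.
have E (X : normedModType R) (h : 'rV[R]_m -> X) :
    'D_v h x = 'D_1 (fun s : R => h (s *: v + x)) 0.
  rewrite /derive; set g1 := fun s => s^-1 *: _; set g2 := fun s => s^-1 *: _.
  suff -> : g1 = g2 by [].
  by apply/funext => s; rewrite /g1 /g2 /= addr0 scale0r add0r [_%:A]mulr1.
apply: DeriveDef.
  by apply/derivable1P/derivable1_diffP.
rewrite !E -[X in derive X]/(g \o p) -[X in _ = _ (derive X _ _)]/p -p0.
by rewrite deriveE// diff_comp//= deriveE.
Qed.

Lemma derive_comp_row m n (f : 'rV[R]_m -> 'rV[R]_n) (g : 'rV[R]_n -> R) x v :
  derivable f x v -> differentiable g (f x) ->
  'D_v (g \o f) x = \sum_j 'D_v (fun y => f y 0 j) x * 'D_(e_ j) g (f x).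
Proof.
move=> df dg; have [_ ->] := is_derive_comp_diff df dg.
by rewrite diff_partial//; apply: eq_bigr => j _; rewrite derive_mx// mxE.
Qed.

Lemma Ck_on_comp1 m n k U V (f : 'rV[R]_m -> 'rV[R]_n) (g : 'rV[R]_n -> R) :
  open U -> open V -> (forall x, U x -> V (f x)) ->
  Ck_on k U f -> Ck_on k V g -> Ck_on k U (g \o f).
Proof.
move=> oU oV fUV; elim: k f g fUV => [|k IH] f g fUV Uf Vg.
  split=> // x Ux; apply: continuous_comp (Ck_cont Uf Ux) _.
  exact: Ck_cont Vg _ (fUV _ Ux).
split=> [x Ux|i].
  by apply: continuous_comp (Ck_cont Uf Ux) _; exact: Ck_cont Vg _ (fUV _ Ux).
have dg x : U x -> differentiable g (f x).
  by move=> Ux; apply: Ck_on_differentiable (fUV _ Ux) Vg.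
have df x : U x -> derivable f x (e_ i) by case: Uf => _ /(_ i)[+ _]; apply.
split=> [x Ux|]; first by have [] := is_derive_comp_diff (df _ Ux) (dg _ Ux).
apply: (@Ck_on_ext _ _ k U (fun x => \sum_(j < n)
   ('D_(e_ i) (fun y => f y 0 j) * ('D_(e_ j) g \o f)) x)) => //.
  by move=> x Ux; rewrite derive_comp_row//; auto.
apply: Ck_on_sum => // j; apply: Ck_onM => //.
  by have /Ck_on_rowP -/(_ oU j)[_ /(_ i)[]] := Uf.
by apply: IH; [exact: fUV|exact: Ck_onW|have [_ /(_ j)[]] := Vg].
Qed.

Lemma Cinfty_on_comp m n p U V (f : 'rV[R]_m -> 'rV[R]_n)
    (g : 'rV[R]_n -> 'rV[R]_p) :
  open U -> open V -> (forall x, U x -> V (f x)) ->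
  Cinfty_on U f -> Cinfty_on V g -> Cinfty_on U (g \o f).
Proof.
move=> oU oV fUV /Cinfty_onP Uf /Cinfty_onP Vg; apply/Cinfty_onP => k.
apply/Ck_on_rowP => // j.
apply: (Ck_on_comp1 (g := fun y => g y 0 j) oU oV fUV (Uf k)).
by move: j; apply/Ck_on_rowP.
Qed.

Lemma Cinfty_on_ext m (W : normedModType R) U (f g : 'rV[R]_m -> W) : open U ->
  (forall x, U x -> f x = g x) -> Cinfty_on U f -> Cinfty_on U g.
Proof.
move=> oU fg /Cinfty_onP Uf; apply/Cinfty_onP => k.
exact: Ck_on_ext (Uf k).
Qed.

Lemma Cinfty_on_local m (W : normedModType R) U (f : 'rV[R]_m -> W) :
  (forall x, U x -> exists2 V, V x & Cinfty_on V f) -> Cinfty_on U f.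
Proof. by move=> Uf w x /Uf[V Vx]; apply. Qed.

Lemma Cinfty_on_sub m (W : normedModType R) U V (f : 'rV[R]_m -> W) :
  V `<=` U -> Cinfty_on U f -> Cinfty_on V f.
Proof. by move=> VU Uf w x /VU; exact: Uf. Qed.

Lemma Cinfty_on_row_mx m n (a : 'rV[R]_m) U :
  open U -> Cinfty_on U (fun v : 'rV[R]_n => row_mx a v).
Proof.
move=> oU; apply/Cinfty_onP => k; apply/Ck_on_rowP => // j.
case: (split_ordP j) => [j' ->|j' ->].
  apply: (@Ck_on_ext _ _ k U (cst (a 0 j'))) => //; last exact: Ck_on_cst.
  by move=> x _; rewrite row_mxEl.
apply: (@Ck_on_ext _ _ k U (fun x => x 0 j')) => //.
  by move=> x _; rewrite row_mxEr.
have dfc x v : is_derive x v (fun y : 'rV[R]_n => y 0 j') (v 0 j').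
  have [d1 d2] := is_derive_id x v.
  apply: DeriveDef; first by have /derivable_mxP := d1; exact.
  by have := derive_mx d1; rewrite d2 => /rowP/(_ j'); rewrite mxE => <-.
case: k => [|k]; (split; first by move=> x _; exact: coord_continuous) => //.
move=> i; split=> [x _|]; first by have [] := dfc x (e_ i).
apply: (@Ck_on_ext _ _ k U (cst ((e_ i : 'rV[R]_n) 0 j'))) => //.
  by move=> x _; have [_ ->] := dfc x (e_ i).
exact: Ck_on_cst.
Qed.

End Ck.

Section Jets.
Context {R : realType}.
Local Notation e_ i := (delta_mx 0 i).

Fixpoint eq_jet (m : nat) (W : normedModType R) (k : nat) (x : 'rV[R]_m)
    (f f' : 'rV[R]_m -> W) : Prop :=
  f x = f' x /\
  if k is k'.+1 then forall i, eq_jet k' x ('D_(e_ i) f) ('D_(e_ i) f')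
  else True.

Section Generic.
Context {m : nat} {W : normedModType R}.
Implicit Types (f g : 'rV[R]_m -> W) (U : set 'rV[R]_m).

Lemma eq_jetP k x f f' : eq_jet k x f f' <->
  forall w, (size w <= k)%N -> pderiv f w x = pderiv f' w x.
Proof.
elim: k f f' => [|k IH] f f'.
  split=> [[e _] [|//] //|h]; split=> //; exact: (h [::]).
split=> [[e h]|h].
- elim/last_ind => [//|w i _]; rewrite size_rcons ltnS !pderiv_rcons.
  by have /IH := h i; apply.
- split; first exact: (h [::]).
  move=> i; apply/IH => w wk; rewrite -!pderiv_rcons; apply: h.
  by rewrite size_rcons.
Qed.

Lemma eq_jetW k x f f' : eq_jet k.+1 x f f' -> eq_jet k x f f'.
Proof. by move=> /eq_jetP h; apply/eq_jetP => w wk; apply: h; exact: leqW. Qed.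

Lemma eq_jet_trans k x f g h : eq_jet k x f g -> eq_jet k x g h ->
  eq_jet k x f h.
Proof.
by move=> /eq_jetP a /eq_jetP b; apply/eq_jetP => w wk; rewrite a ?b.
Qed.

Lemma eq_jet_sym k x f g : eq_jet k x f g -> eq_jet k x g f.
Proof. by move=> /eq_jetP a; apply/eq_jetP => w wk; rewrite a. Qed.

Lemma eq_jet_open k U x f g : open U -> U x -> (forall y, U y -> f y = g y) ->
  eq_jet k x f g.
Proof.
move=> oU Ux; elim: k f g => [|k IH] f g fg; split; rewrite ?fg//.
move=> i; apply: IH => y Uy; apply: near_eq_derive.
exact: filterS (open_nbhs_nbhs (conj oU Uy)).
Qed.

Lemma eq_jet_ext k U x f f' g g' : open U -> U x ->
  (forall y, U y -> f y = g y) -> (forall y, U y -> f' y = g' y) ->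
  eq_jet k x f f' -> eq_jet k x g g'.
Proof.
move=> oU Ux fg fg' h; apply: eq_jet_trans (eq_jet_open k oU Ux fg').
by apply: eq_jet_trans h; apply: eq_jet_sym; exact: eq_jet_open fg.
Qed.

Lemma eq_jetD k U x f f' g g' : open U -> U x ->
  Ck_on k U f -> Ck_on k U f' -> Ck_on k U g -> Ck_on k U g' ->
  eq_jet k x f f' -> eq_jet k x g g' -> eq_jet k x (f + g) (f' + g').
Proof.
move=> oU Ux; elim: k f f' g g' => [|k IH] f f' g g'.
  move=> _ _ _ _ [ef _] [eg _]; split=> //.
  by rewrite -[LHS]/(f x + g x) ef eg.
move=> [_ Uf] [_ Uf'] [_ Ug] [_ Ug'] [ef jf] [eg jg]; split.
  by rewrite -[LHS]/(f x + g x) ef eg.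
move=> i; apply: (@eq_jet_ext k U x ('D_(e_ i) f + 'D_(e_ i) g)
    ('D_(e_ i) f' + 'D_(e_ i) g')) => //.
- by move=> y Uy; rewrite deriveD; [|exact: (Uf i).1|exact: (Ug i).1].
- by move=> y Uy; rewrite deriveD; [|exact: (Uf' i).1|exact: (Ug' i).1].
- by apply: IH; [exact: (Uf i).2|exact: (Uf' i).2|exact: (Ug i).2
    |exact: (Ug' i).2|exact: jf|exact: jg].
Qed.

Lemma eq_jet_sum k U x (I : Type) (r : seq I) (F F' : I -> 'rV[R]_m -> W) :
  open U -> U x ->
  (forall i, Ck_on k U (F i)) -> (forall i, Ck_on k U (F' i)) ->
  (forall i, eq_jet k x (F i) (F' i)) ->
  eq_jet k x (fun x => \sum_(i <- r) F i x) (fun x => \sum_(i <- r) F' i x).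
Proof.
move=> oU Ux UF UF' h; elim: r => [|i r IH].
  by apply: (@eq_jet_open k setT) => //; [exact: openT|move=> y _; rewrite !big_nil].
apply: (@eq_jet_ext k U x (F i + (fun x => \sum_(j <- r) F j x))
    (F' i + (fun x => \sum_(j <- r) F' j x))) => //.
- by move=> y _; rewrite big_cons.
- by move=> y _; rewrite big_cons.
- by apply: (@eq_jetD k U) => //; exact: Ck_on_sum.
Qed.
End Generic.

Lemma eq_jetM m k U x (f f' g g' : 'rV[R]_m -> R) : open U -> U x ->
  Ck_on k U f -> Ck_on k U f' -> Ck_on k U g -> Ck_on k U g' ->
  eq_jet k x f f' -> eq_jet k x g g' -> eq_jet k x (f * g) (f' * g').
Proof.
move=> oU Ux; elim: k f f' g g' => [|k IH] f f' g g'.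
  move=> _ _ _ _ [ef _] [eg _]; split=> //.
  by rewrite -[LHS]/(f x * g x) ef eg.
move=> cf cf' cg cg' jjf jjg.
have [[_ Uf] [_ Uf'] [_ Ug] [_ Ug']] := And4 cf cf' cg cg'.
have [[ef jf] [eg jg]] := conj jjf jjg; split.
  by rewrite -[LHS]/(f x * g x) ef eg.
move=> i; apply: (@eq_jet_ext _ _ k U x (f * 'D_(e_ i) g + g * 'D_(e_ i) f)
    (f' * 'D_(e_ i) g' + g' * 'D_(e_ i) f')) => //.
- by move=> y Uy; rewrite deriveM; [|exact: (Uf i).1|exact: (Ug i).1].
- by move=> y Uy; rewrite deriveM; [|exact: (Uf' i).1|exact: (Ug' i).1].
have [df df' dg dg'] : [/\ Ck_on k U ('D_(e_ i) f), Ck_on k U ('D_(e_ i) f'),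
    Ck_on k U ('D_(e_ i) g) & Ck_on k U ('D_(e_ i) g')].
  by split; [exact: (Uf i).2|exact: (Uf' i).2|exact: (Ug i).2|exact: (Ug' i).2].
move: cf cf' cg cg' => /Ck_onW cf /Ck_onW cf' /Ck_onW cg /Ck_onW cg'.
move: jjf jjg (jf i) (jg i) => /eq_jetW ? /eq_jetW ? ? ?.
by apply: (@eq_jetD _ _ k U) => //; [exact: Ck_onM..|exact: IH|exact: IH].
Qed.

Lemma eq_jet_row m n k U x (f f' : 'rV[R]_m -> 'rV[R]_n) : open U -> U x ->
  Ck_on k U f -> Ck_on k U f' ->
  eq_jet k x f f' <-> forall j, eq_jet k x (fun y => f y 0 j) (fun y => f' y 0 j).
Proof.
move=> oU Ux; elim: k f f' => [|k IH] f f' Uf Uf'.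
  split=> [[e _] j|h]; split=> //; first by rewrite e.
  by apply/rowP => j; have [] := h j.
have [_ df] := Uf; have [_ df'] := Uf'.
have E i j (h : 'rV[R]_m -> 'rV[R]_n) :
    (forall y, U y -> derivable h y (e_ i)) ->
    forall y, U y -> 'D_(e_ i) h y 0 j = 'D_(e_ i) (fun y => h y 0 j) y.
  by move=> dh y Uy; rewrite derive_mx ?mxE//; exact: dh.
split=> [[e h] j|h].
- split=> [|i]; first by rewrite e.
  have := (IH _ _ (df i).2 (df' i).2).1 (h i) j.
  by apply: (eq_jet_ext oU Ux); apply: E; [exact: (df i).1|exact: (df' i).1].
- split=> [|i]; first by apply/rowP => j; have [] := h j.
  apply/(IH _ _ (df i).2 (df' i).2) => j; have [_ /(_ i)] := h j.
  apply: (eq_jet_ext oU Ux) => y Uy; apply/esym; apply: E => //.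
  - exact: (df i).1.
  - exact: (df' i).1.
Qed.

Lemma eq_jet_comp1 m n k U V x (f f' : 'rV[R]_m -> 'rV[R]_n)
    (g : 'rV[R]_n -> R) : open U -> open V -> U x ->
  (forall y, U y -> V (f y)) -> (forall y, U y -> V (f' y)) ->
  Ck_on k U f -> Ck_on k U f' -> Ck_on k V g ->
  eq_jet k x f f' -> eq_jet k x (g \o f) (g \o f').
Proof.
move=> oU oV Ux fV fV'; elim: k g => [|k IH] g Uf Uf' Vg.
  by move=> [e _]; split=> //=; rewrite e.
move=> jf; have [e _] := jf; split=> [|i] /=; first by rewrite e.
have D h : (forall y, U y -> V (h y)) -> Ck_on k.+1 U h ->
    forall y, U y -> (fun x => \sum_(j < n)
      ('D_(e_ i) (fun y => h y 0 j) * ('D_(e_ j) g \o h)) x) y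
      = 'D_(e_ i) (g \o h) y.
  move=> hV Uh y Uy; rewrite derive_comp_row//; first exact: (Uh.2 i).1.
  exact: Ck_on_differentiable (hV _ Uy) Vg.
apply: (eq_jet_ext oU Ux (D f fV Uf) (D f' fV' Uf')).
have rowf (h : 'rV[R]_m -> 'rV[R]_n) : Ck_on k.+1 U h ->
    forall j, Ck_on k U ('D_(e_ i) (fun y => h y 0 j)).
  by move=> /(Ck_on_rowP _ _ oU) h1 j; have [_ /(_ i)[]] := h1 j.
have Dg j : Ck_on k V ('D_(e_ j) g) by have [_ /(_ j)[]] := Vg.
have cDg h : (forall y, U y -> V (h y)) -> Ck_on k.+1 U h ->
    forall j, Ck_on k U ('D_(e_ j) g \o h).
  by move=> hV /Ck_onW Uh j; exact: Ck_on_comp1 oU oV hV Uh (Dg j).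
apply: (@eq_jet_sum _ _ k U) => // [j|j|j].
- by apply: Ck_onM; [|exact: rowf|exact: cDg].
- by apply: Ck_onM; [|exact: rowf|exact: cDg].
- apply: (@eq_jetM _ k U) => //; [exact: rowf|exact: rowf|exact: cDg|exact: cDg| |].
  + by have /(eq_jet_row oU Ux Uf Uf') -/(_ j)[_ /(_ i)] := jf.
  + by apply: IH => //; [exact: Ck_onW|exact: Ck_onW|exact: eq_jetW].
Qed.

Lemma pderiv_comp m n p k U V x (f f' : 'rV[R]_m -> 'rV[R]_n)
    (g : 'rV[R]_n -> 'rV[R]_p) : open U -> open V -> U x ->
  (forall y, U y -> V (f y)) -> (forall y, U y -> V (f' y)) ->
  Cinfty_on U f -> Cinfty_on U f' -> Cinfty_on V g ->
  (forall w, (size w <= k)%N -> pderiv f w x = pderiv f' w x) ->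
  forall w, (size w <= k)%N -> pderiv (g \o f) w x = pderiv (g \o f') w x.
Proof.
move=> oU oV Ux fV fV' Uf Uf' Vg /eq_jetP jf; apply/eq_jetP.
have /Cinfty_onP Ugf := Cinfty_on_comp oU oV fV Uf Vg.
have /Cinfty_onP Ugf' := Cinfty_on_comp oU oV fV' Uf' Vg.
move: Uf Uf' Vg => /Cinfty_onP Uf /Cinfty_onP Uf' /Cinfty_onP Vg.
apply/(eq_jet_row oU Ux) => // j.
apply: (eq_jet_comp1 (g := fun y => g y 0 j) oU oV) => //.
by have /Ck_on_rowP := Vg k; apply.
Qed.

End Jets.

Section SmoothMaps.
Context {R : realType}.

Lemma open_setI_preimage (M N : topologicalType) (U : set M) (V : set N)
    (f : M -> N) : open U -> open V ->
  (forall x, U x -> {for x, continuous f}) -> open (U `&` f @^-1` V).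
Proof.
move=> oU oV cf; rewrite openE => x [Ux Vfx].
apply: filterI; first exact: open_nbhs_nbhs (conj oU Ux).
exact: (cf x Ux _ (open_nbhs_nbhs (conj oV Vfx))).
Qed.

Lemma chart_image_open n (M : topologicalType) (c : chart R n M) (S : set M) :
  is_chart c -> open S -> open (c @` (S `&` chart_dom c)).
Proof.
move=> [od oi cK _ ci] oS.
have -> : c @` (S `&` chart_dom c) =
    c @` chart_dom c `&` chart_inv c @^-1` (S `&` chart_dom c).
  rewrite eqEsubset; split=> [_ [x [Sx dx] <-]|_ [[x dx <-]]] /=.
    by split; [exists x|rewrite /= cK].
  by rewrite cK// => -[Sx _]; exists x.
by apply: open_setI_preimage => //; exact: openI.
Qed.

Lemma is_chart_euclid n c : euclid_atlas R n c -> is_chart c.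
Proof.
move=> ->; split=> //=; first exact: openT.
- by rewrite image_id; exact: openT.
- by move=> x _; exact: cvg_id.
- by move=> x _; exact: cvg_id.
Qed.

Lemma lsubmx_continuous m n : continuous (@lsubmx R 1 m n).
Proof.
by move=> v; apply: differentiable_continuous; exact: differentiable_lsubmx.
Qed.

Lemma rsubmx_continuous m n : continuous (@rsubmx R 1 m n).
Proof.
by move=> v; apply: differentiable_continuous; exact: differentiable_rsubmx.
Qed.

Lemma is_chart_prod m n (M N : topologicalType) (c : chart R m M)
    (d : chart R n N) : is_chart c -> is_chart d -> is_chart (prod_chart c d).
Proof.
move=> [oc oci cK cc ci] [od odi dK dc di].
have E : prod_chart c d @` chart_dom (prod_chart c d) =
    lsubmx @^-1` (c @` chart_dom c) `&` rsubmx @^-1` (d @` chart_dom d).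
  rewrite eqEsubset; split=> [_ [[x y] [/= Dx Dy] <-]|v [[x Dx ex] [y Dy ey]]].
    by rewrite /= row_mxKl row_mxKr; split; [exists x|exists y].
  by exists (x, y); rewrite //= ex ey hsubmxK.
split.
- rewrite openE => -[x y] [/= Dx Dy]; exists (chart_dom c, chart_dom d) => //.
  by split; [exact: open_nbhs_nbhs (conj oc Dx)|exact: open_nbhs_nbhs (conj od Dy)].
- rewrite E; apply: openI; apply: open_comp => // v _.
    exact: lsubmx_continuous.
  exact: rsubmx_continuous.
- by move=> [x y] [/= Dx Dy]; rewrite row_mxKl row_mxKr cK// dK.
- move=> [x y] [/= Dx Dy]; apply/continuous_rowP => j /=.
  case: (split_ordP j) => [j' ->|j' ->].
    apply: (@near_eq_continuous _ _ (fun p : M * N => c p.1 0 j')).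
      by near=> p; rewrite row_mxEl.
    apply: (@continuous_comp _ _ _ fst (fun x => c x 0 j')); first exact: cvg_fst.
    by have /continuous_rowP := cc _ Dx; apply.
  apply: (@near_eq_continuous _ _ (fun p : M * N => d p.2 0 j')).
    by near=> p; rewrite row_mxEr.
  apply: (@continuous_comp _ _ _ snd (fun x => d x 0 j')); first exact: cvg_snd.
  by have /continuous_rowP := dc _ Dy; apply.
- move=> v; rewrite E => -[Cv Dv] /=.
  apply: (@cvg_pair _ _ _ (nbhs v)).
    apply: (@continuous_comp _ _ _ (@lsubmx R 1 m n) (chart_inv c) v);
      [exact: lsubmx_continuous|exact: ci].
  apply: (@continuous_comp _ _ _ (@rsubmx R 1 m n) (chart_inv d) v);
    [exact: rsubmx_continuous|exact: di].
Unshelve. all: by end_near. Qed.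

Lemma smooth_on_comp m n p (M N P : topologicalType)
    (A : set (chart R m M)) (B : set (chart R n N)) (C : set (chart R p P))
    (U : set M) (V : set N) (f : M -> N) (g : N -> P) :
  (forall c, A c -> is_chart c) -> (forall c, B c -> is_chart c) ->
  (forall c, C c -> is_chart c) ->
  (forall y, exists2 d, B d & chart_dom d y) ->
  open U -> open V -> (forall x, U x -> V (f x)) ->
  smooth_on A B U f -> smooth_on B C V g -> smooth_on A C U (g \o f).
Proof.
move=> Ach Bch Cch Bcov oU oV fUV [cf sf] [cg sg]; split=> [x Ux|c e Ac Ce].
  by apply: continuous_comp; [exact: cf|exact: cg (fUV _ Ux)].
apply: Cinfty_on_local => _ [x [[Ux cx] ex] <-].
have [d Bd dx] := Bcov (f x).
have [[oc _ cK _ _] [od _ dK _ _] [oe _ _ _ _]] := And3 (Ach _ Ac) (Bch _ Bd) (Cch _ Ce).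
pose T := V `&` g @^-1` chart_dom e.
have oT : open T by exact: open_setI_preimage.
pose S := U `&` f @^-1` (T `&` chart_dom d).
have oS : open S by apply: open_setI_preimage => //; exact: openI.
exists (c @` (S `&` chart_dom c)).
  by exists x => //; split=> //; split=> //; split=> //; split=> //; exact: fUV.
have oO : open (c @` (S `&` chart_dom c)) by apply: chart_image_open => //; exact: Ach.
have oO' : open (d @` (T `&` chart_dom d)) by apply: chart_image_open => //; exact: Bch.
apply: (@Cinfty_on_ext _ _ _ _ ((e \o g \o chart_inv d) \o (d \o f \o chart_inv c))) => //.
  by move=> _ [y [[Uy [_ dy]] cy] <-]; rewrite /= cK// dK.
apply: (Cinfty_on_comp oO oO').
- move=> _ [y [[Uy [Ty dy]] cy] <-] /=; rewrite cK//.
  by exists (f y).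
- apply: Cinfty_on_sub (sf _ _ Ac Bd) => _ [y [[Uy [Ty dy]] cy] <-].
  by exists y.
- apply: Cinfty_on_sub (sg _ _ Bd Ce) => _ [y [[Vy ey] dy] <-].
  by exists y.
Qed.
End SmoothMaps.

Section Prolongation.
Context {R : realType} {m n : nat} {G : lieGroupType R m}
  {M : manifoldType R n} (a : smooth_action G M).

Lemma actK g : cancel (a g) (a g^-1%g).
Proof. by move=> x; rewrite -actM mulVg act1. Qed.

Lemma actKV g : cancel (a g^-1%g) (a g).
Proof. by move=> x; rewrite -actM mulgV act1. Qed.

Lemma act_smooth1 g : smooth_on (atlas M) (atlas M) setT (a g).
Proof.
have [ca sa] := act_smooth a; split=> [x _|e d Ae Ad].
  apply: (@continuous_comp _ _ _ (fun x => (g, x)) (fun gx => a gx.1 gx.2)).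
    by apply: cvg_pair; [exact: cvg_cst|exact: cvg_id].
  exact: ca.
have [c Ac cg] := @atlas_cover R m G g.
have [ch1 ch2 ch3] := And3 (atlas_chart _ Ac) (atlas_chart _ Ae) (atlas_chart _ Ad).
have [_ _ cK _ _] := ch1; have [oe _ eK _ _] := ch2; have [od _ _ _ _] := ch3.
have chp := is_chart_prod ch1 ch2.
pose S := setT `&` a g @^-1` chart_dom d.
have cag x : setT x -> {for x, continuous (a g)}.
  move=> _; apply: (@continuous_comp _ _ _ (fun x => (g, x)) (fun gx => a gx.1 gx.2)).
    by apply: cvg_pair; [exact: cvg_cst|exact: cvg_id].
  exact: ca.
have oS : open S by apply: open_setI_preimage => //; exact: openT.
have oO : open (e @` (setT `&` chart_dom e `&` a g @^-1` chart_dom d)).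
  by rewrite setIAC; exact: chart_image_open.
pose T := setT `&` (fun gx => a gx.1 gx.2) @^-1` chart_dom d.
have oT : open T by apply: open_setI_preimage => //; exact: openT.
have oO' := chart_image_open chp oT.
apply: (@Cinfty_on_ext _ _ _ _ ((d \o (fun gx => a gx.1 gx.2)
    \o chart_inv (prod_chart c e)) \o (fun v => row_mx (c g) v))) => //.
  by move=> _ [x _ <-] /=; rewrite row_mxKl row_mxKr cK.
apply: (Cinfty_on_comp oO oO'); last 2 first.
- exact: Cinfty_on_row_mx.
- apply: Cinfty_on_sub (sa _ _ _ Ad); first by rewrite setIAC.
  by exists c => //; exists e.
move=> _ [x [[_ ex] dx] <-].
by exists (g, x).
Qed.

Lemma act_continuous1 g : continuous (a g).
Proof. by move=> x; have [+ _] := act_smooth1 g; apply. Qed.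

Lemma act_local_diffeo0 g (phi : 'rV[R]_n -> M) : local_diffeo0 phi ->
  local_diffeo0 (a g \o phi).
Proof.
move=> [U [psi [[oU U0] oI psiK sphi spsi]]].
exists U, (psi \o a g^-1%g).
have oI' : open ((a g \o phi) @` U).
  have -> : (a g \o phi) @` U = a g^-1%g @^-1` (phi @` U).
    rewrite eqEsubset; split=> [_ [v Uv <-]|x [v Uv ev]] /=.
      by exists v => //; rewrite actK.
    by exists v => //=; rewrite ev actKV.
  by apply: open_comp => // x _; exact: act_continuous1.
have ech := @is_chart_euclid R n; have ach := @atlas_chart R n M.
split=> //.
- by move=> v Uv /=; rewrite actK psiK.
- exact: (smooth_on_comp ech ach ach (@atlas_cover R n M) oU openT _ sphi
    (act_smooth1 g)).
- apply: (smooth_on_comp ach ach ech (@atlas_cover R n M) oI' oI _ _ spsi).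
    by move=> _ [v Uv <-] /=; rewrite actK; exists v.
  have [c1 c2] := act_smooth1 g^-1%g; split=> [x _|c d Ac Ad]; first exact: c1.
  by apply: Cinfty_on_sub (c2 _ _ Ac Ad) => _ [x [[_ cx] dx] <-]; exists x.
Qed.

Definition frame_act (g : G) (phi : local_frame M) : local_frame M :=
  let: LocalFrame f fP := phi in LocalFrame (act_local_diffeo0 g fP).

(* Independent of the representative, see [prolongE]. *)
Definition prolong (k : nat) (g : G) (j : frame_bundle M k) :
    frame_bundle M k := jet k (frame_act g (frame_repr j)).

Lemma same_jet_act k g (phi psi : local_frame M) :
  same_jet k phi psi -> same_jet k (frame_act g phi) (frame_act g psi).
Proof.
case: phi psi => [f fP] [h hP] /= [e0 E]; split=> [|d Ad df] /=; first by rewrite e0.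
have [c Ac cf] := @atlas_cover R n M (f 0).
have [ch1 ch2] := conj (atlas_chart _ Ac) (atlas_chart _ Ad).
have [oc _ cK _ _] := ch1; have [od _ _ _ _] := ch2.
have [U [_ [[oU U0] _ _ [cfU sf] _]]] := fP.
have [V [_ [[oV V0] _ _ [chV sh] _]]] := hP.
pose S := a g @^-1` chart_dom d.
have oS : open S by apply: open_comp => // x _; exact: act_continuous1.
have oSc : open (S `&` chart_dom c) by exact: openI.
pose W := (U `&` f @^-1` (S `&` chart_dom c)) `&` (V `&` h @^-1` (S `&` chart_dom c)).
have oW : open W by apply: openI; exact: open_setI_preimage.
have W0 : W 0 by rewrite /W /= -e0.
have oO := chart_image_open ch1 oS.
have Eag (F : 'rV[R]_n -> M) : (forall v, W v -> chart_dom c (F v)) ->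
    forall v, W v -> ((d \o a g \o chart_inv c) \o (c \o F)) v = (d \o (a g \o F)) v.
  by move=> cF v Wv /=; rewrite cK//; exact: cF.
have Wf v : W v -> (S `&` chart_dom c) (f v) by move=> [[]].
have Wh v : W v -> (S `&` chart_dom c) (h v) by move=> [_ []].
have P F : smooth_on (euclid_atlas R n) (atlas M) W F ->
    (forall v, W v -> (S `&` chart_dom c) (F v)) -> Cinfty_on W (c \o F).
  move=> [_ sF] WF.
  apply: Cinfty_on_sub (sF _ _ (erefl _) Ac) => v Wv /=.
  by exists v => //; split=> //; exact: (WF _ Wv).2.
have smW F X : W `<=` X -> smooth_on (euclid_atlas R n) (atlas M) X F ->
    smooth_on (euclid_atlas R n) (atlas M) W F.
  move=> WX [cF sF]; split=> [v /WX|x y Ax Ay]; first exact: cF.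
  apply: Cinfty_on_sub (sF _ _ Ax Ay) => _ [v [[Wv xv] yv] <-].
  by exists v => //; split=> //; split=> //; exact: WX.
have jetF (F : 'rV[R]_n -> M) : (forall v, W v -> (S `&` chart_dom c) (F v)) ->
    forall w, pderiv (d \o (a g \o F)) w 0 =
      pderiv ((d \o a g \o chart_inv c) \o (c \o F)) w 0.
  move=> WF w; apply/esym.
  have /eq_jetP := @eq_jet_open _ _ _ (size w) W 0 _ _ oW W0
    (Eag F (fun v Wv => (WF v Wv).2)).
  exact.
move=> w wk; rewrite (jetF f Wf) (jetF h Wh).
apply: (pderiv_comp oW oO W0 _ _ _ _ _ _ wk).
- by move=> v Wv; exists (f v) => //; exact: Wf.
- by move=> v Wv; exists (h v) => //; exact: Wh.
- by apply: P Wf; apply: (smW _ U) => // v [[]].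
- by apply: P Wh; apply: (smW _ V) => // v [_ []].
- have [_ sg] := act_smooth1 g.
  apply: Cinfty_on_sub (sg _ _ Ac Ad) => _ [x [Sx cx] <-].
  by exists x.
- by move=> w' w'k; apply: E.
Qed.

Lemma prolongE k g (phi : local_frame M) :
  prolong g (jet k phi) = jet k (frame_act g phi).
Proof.
apply/eqmodP/asboolP/same_jet_act.
have /eqmodP/asboolP// : frame_repr (jet k phi) = phi %[mod frame_bundle M k].
by rewrite reprK.
Qed.

End Prolongation.

Arguments prolong {R m n G M} a k g j.

(* Main.v *)
(** Suppose [g] fixes the [l]-jet of a frame [phi] at [p].  By properness the
    stabiliser [K] of that jet is compact, and it contains all powers of [g].
    In the coordinates given by [phi], every [h] in [K] fixes [0] with identity
    differential, so by compactness there is one ball around [0] on which every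
    [h - id], [h] in [K], is 1/2-Lipschitz.  For [u] near [0] put
    [u_k := g^k u] and [d := g u - u].  Then [u_(k+1) - u_k = g^k (g u) - g^k u]
    lies within [|d| / 2] of [d] while [u_k] stays bounded, which forces [d = 0]:
    [g] is the identity near [p].  This replaces the usual averaging over [K].

    Hence the interior of the fixed point set of [g] contains [p].  It is also
    closed: at a point of its closure, [g] has the jet of the identity by
    continuity of the derivatives, and the previous argument applies again.  So
    it contains the component of [p], and effectiveness gives [g = 1]. *)
Require Import Defs.
From mathcomp Require Import all_boot all_order all_algebra.
From mathcomp Require Import all_classical all_reals all_analysis.
From mathcomp Require Import lra.

Set Implicit Arguments.
Unset Strict Implicit.
Unset Printing Implicit Defensive.

Import Order.TTheory GRing.Theory Num.Theory.
Import numFieldNormedType.Exports.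

(** * Lipschitz estimates near the identity, and sequences with almost constant increments *)

Section NearIdentity.
Local Open Scope classical_set_scope.
Local Open Scope ring_scope.
Context {R : realType}.
Local Notation e_ i := (delta_mx 0 i).

Lemma norm_ball0 (V : normedModType R) (r : R) (v : V) :
  ball (0 : V) r v = (`|v| < r) :> Prop.
Proof. by rewrite -ball_normE /ball_/= sub0r normrN. Qed.

Lemma norm_coord_le n (v : 'rV[R]_n) i : `|v 0 i| <= `|v|.
Proof.
rewrite [leRHS]/Num.Def.normr/= mx_normrE.
exact: (le_bigmax _ (fun ij => `|v ij.1 ij.2|) (0, i)).
Qed.

Lemma norm_row_le n (v : 'rV[R]_n) (b : R) : 0 <= b ->
  (forall i, `|v 0 i| <= b) -> `|v| <= b.
Proof.
move=> b0 vb; rewrite [leLHS]/Num.Def.normr/= mx_normrE.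
by apply/bigmax_leP; split => // -[i0 i] _ /=; rewrite ord1.
Qed.

(** Mean value theorem along the segment from [w] to [v]. The factor [n] appears because the
    derivative in the direction [v - w] is a sum of [n] partial derivatives weighted by coordinates,
    each at most the sup norm of [v - w]. *)
Lemma ball_lipschitz n (f : 'rV[R]_n -> R) (r e : R) :
  (forall v, `|v| < r -> differentiable f v) ->
  (forall v i, `|v| < r -> `|'D_(e_ i) f v| <= e) ->
  forall v w, `|v| < r -> `|w| < r -> `|f v - f w| <= n%:R * e * `|v - w|.
Proof.
move=> df De v w vr wr.
(* The ball is convex, so the estimates on the partial derivatives hold along the whole segment. *)
have seg t : t \in `[0, 1]%R -> `|t *: (v - w) + w| < r.
  rewrite in_itv/= => /andP[t0 t1].
  have -> : t *: (v - w) + w = t *: v + (1 - t) *: w.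
    by rewrite scalerBr scalerBl scale1r addrAC addrA.
  have s0 : 0 <= 1 - t by rewrite subr_ge0.
  have := ler_normD (t *: v) ((1 - t) *: w); rewrite !normrZ !ger0_norm//.
  move=> /le_lt_trans; apply.
  move: `|v| `|w| vr wr => x y xr yr.
  (* The strict bound comes from the term in [v], whose weight [t] must be positive; at [t = 0] it
     comes from [w]. *)
  have [->|tn0] := eqVneq t 0; first lra.
  have tp : 0 < t by rewrite lt_def tn0.
  have : t * x < t * r by rewrite ltr_pM2l.
  have : (1 - t) * y <= (1 - t) * r by rewrite ler_wpM2l// ltW.
  lra.
have fd t : t \in `[0, 1]%R -> is_derive (t : R) 1
    (fun s : R => f (s *: (v - w) + w)) ('D_(v - w) f (t *: (v - w) + w)).
  by move=> /seg tI; apply: is_derive_line; apply: diff_derivable; exact: df.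
have [|c cI] := @MVT_segment R (fun s => f (s *: (v - w) + w)) _ 0 1 ler01
    (fun t tI => fd t (subset_itv_oo_cc tI)).
  by apply: derivable_within_continuous => t /fd[].
rewrite scale1r subrK scale0r add0r subr0 mulr1 => ->.
rewrite deriveE ?diff_partial; try exact/df/seg.
rewrite (le_trans (ler_norm_sum _ _ _))//.
rewrite (@le_trans _ _ (\sum_(j < n) `|v - w| * e))//.
  apply: ler_sum => j _; rewrite normrM ler_pM//; first exact: norm_coord_le.
  exact: De (seg _ cI).
by rewrite sumr_const card_ord -mulrA (mulrC e) mulr_natl.
Qed.

Lemma is_derive_coord n (j : 'I_n) (x v : 'rV[R]_n) :
  is_derive x v (fun y : 'rV[R]_n => y 0 j) (v 0 j).
Proof.
have [d1 d2] := is_derive_id x v.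
apply: DeriveDef; first by have /derivable_mxP := d1; exact.
by have := derive_mx d1; rewrite d2 => /rowP/(_ j); rewrite mxE => <-.
Qed.

(** The norm is the sup norm, so it suffices to apply [ball_lipschitz] to each coordinate of
    [F - id], whose partial derivatives are at most [e]. *)
Lemma near_id_lipschitz n (F : 'rV[R]_n -> 'rV[R]_n) (r e : R) :
  0 <= e ->
  (forall v j, `|v| < r -> differentiable (fun y => F y 0 j) v) ->
  (forall v i j, `|v| < r ->
    `|'D_(e_ i) (fun y => F y 0 j) v - (e_ i : 'rV[R]_n) 0 j| <= e) ->
  forall v w, `|v| < r -> `|w| < r ->
    `|F v - F w - (v - w)| <= n%:R * e * `|v - w|.
Proof.
move=> e0 dF DF v w vr wr; apply: norm_row_le => [|j]; first by rewrite !mulr_ge0.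
pose f := (fun y => F y 0 j) - (fun y : 'rV[R]_n => y 0 j).
have -> : (F v - F w - (v - w)) 0 j = f v - f w.
  by rewrite !mxE /f !fctE; lra.
apply: (@ball_lipschitz _ _ r) => // {vr wr}v => [|i] vr.
  apply: differentiableB; first exact: dF.
  exact: differentiable_coord.
have [dc Dc] := is_derive_coord j v (e_ i).
by rewrite deriveB// ?Dc; [exact: DF|apply: diff_derivable; exact: dF].
Qed.

(** Summing [N] increments puts [u N - u 0] within [N |d| / 2] of [N d]. Its norm is thus at least
    [N |d| / 2], and at most [2 B], for every [N]. *)
Lemma bounded_drift (V : normedModType R) (u : nat -> V) (d : V) (B : R) :
  (forall k, `|u k.+1 - u k - d| <= 2^-1 * `|d|) -> (forall k, `|u k| <= B) ->
  d = 0.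
Proof.
move=> ud uB; apply/eqP; rewrite -normr_le0 leNgt; apply/negP => d0.
have drift N : `|u N - u 0%N - d *+ N| <= 2^-1 * `|d| *+ N.
  elim: N => [|N IH]; first by rewrite subrr mulr0n subr0 normr0.
  rewrite mulrS [in leRHS]mulrS.
  have -> : u N.+1 - u 0%N - (d + d *+ N) =
      (u N.+1 - u N - d) + (u N - u 0%N - d *+ N).
    by rewrite addrACA -opprD addrA subrK.
  by rewrite (le_trans (ler_normD _ _))// lerD.
(* This is [N |d| / 2 > 2 B], contradicting the two bounds. *)
have [N NB] : exists N : nat, 4 * B / `|d| < N%:R.
  exists (Num.Def.truncn (4 * B / `|d|)).+1; exact: truncnS_gt.
have := drift N; rewrite -(mulr_natl _ N) => h.
have : `|d *+ N| <= `|u N| + `|u 0%N| + `|u N - u 0%N - d *+ N|.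
  have {1}-> : d *+ N = (u N - u 0%N) - (u N - u 0%N - d *+ N).
    by rewrite opprB addrCA subrr addr0.
  by rewrite (le_trans (ler_normB _ _))// lerD// ler_normB.
rewrite normrMn -mulr_natl; have := uB N; have := uB 0%N.
by move: NB; rewrite ltr_pdivrMr// => ? ? ? ?; lra.
Qed.
End NearIdentity.

(** * Smoothness of elementary maps, partial derivatives of slices, frames from charts *)

Section SmoothTools.
Local Open Scope classical_set_scope.
Local Open Scope ring_scope.
Context {R : realType}.
Local Notation e_ i := (delta_mx 0 i).

Lemma Ck_on_coord n k (U : set 'rV[R]_n) (j : 'I_n) : open U ->
  Ck_on k U (fun x : 'rV[R]_n => x 0 j).
Proof.
move=> oU.
case: k => [|k]; (split; first by move=> x _; exact: coord_continuous) => //.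
move=> i; split=> [x _|]; first by have [] := is_derive_coord j x (e_ i).
apply: (@Ck_on_ext _ _ _ k U (cst ((e_ i : 'rV[R]_n) 0 j))) => //.
  by move=> x _; have [_ ->] := is_derive_coord j x (e_ i).
exact: Ck_on_cst.
Qed.

Lemma Cinfty_on_translate n (U : set 'rV[R]_n) (b : 'rV[R]_n) : open U ->
  Cinfty_on U (fun v => v + b).
Proof.
move=> oU; apply/Cinfty_onP => k; apply/Ck_on_rowP => // j.
apply: (@Ck_on_ext _ _ _ k U ((fun x : 'rV[R]_n => x 0 j) + cst (b 0 j))) => //.
  by move=> x _; rewrite mxE.
by apply: Ck_onD => //; [exact: Ck_on_coord|exact: Ck_on_cst].
Qed.

Lemma smooth_on_sub m n (M N : topologicalType) (A : set (chart R m M))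
    (B : set (chart R n N)) (U V : set M) (f : M -> N) :
  V `<=` U -> smooth_on A B U f -> smooth_on A B V f.
Proof.
move=> VU [cf sf]; split=> [x /VU|c d Ac Bd]; first exact: cf.
apply: Cinfty_on_sub (sf _ _ Ac Bd) => _ [x [[Vx cx] dx] <-].
by exists x => //; split=> //; split=> //; exact: VU.
Qed.

Lemma continuous_pair (T T1 T2 : topologicalType) (f : T -> T1) (g : T -> T2)
    (x : T) : {for x, continuous f} -> {for x, continuous g} ->
  {for x, continuous (fun y => (f y, g y))}.
Proof. by move=> cf cg; exact: (@cvg_pair _ _ _ (nbhs x)). Qed.

Lemma row_mx_continuous m n : continuous
  (fun p : 'rV[R]_m * 'rV[R]_n => row_mx p.1 p.2).
Proof.
move=> p; apply/continuous_rowP => j /=.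
case: (split_ordP j) => [j' ->|j' ->].
  apply: (@near_eq_continuous _ _ (fun p : 'rV[R]_m * 'rV[R]_n => p.1 0 j')).
    by near=> q; rewrite row_mxEl.
  apply: (@continuous_comp _ _ _ fst (fun x : 'rV[R]_m => x 0 j')); first exact: cvg_fst.
  exact: coord_continuous.
apply: (@near_eq_continuous _ _ (fun p : 'rV[R]_m * 'rV[R]_n => p.2 0 j')).
  by near=> q; rewrite row_mxEr.
apply: (@continuous_comp _ _ _ snd (fun x : 'rV[R]_n => x 0 j')); first exact: cvg_snd.
exact: coord_continuous.
Unshelve. all: by end_near. Qed.

(** Turns a partial derivative of a slice into one of the joint function, so that its continuity in
    the parameter [s] and in [u] together becomes available. *)
Lemma derive_row_mx m n (W : normedModType R) (f : 'rV[R]_(m + n) -> W)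
    (s : 'rV[R]_m) (u : 'rV[R]_n) (i : 'I_n) :
  'D_(e_ i) (fun v => f (row_mx s v)) u = 'D_(e_ (rshift m i)) f (row_mx s u).
Proof.
rewrite /derive; set g1 := fun _ => _; set g2 := fun _ => _.
suff -> : g1 = g2 by [].
apply/funext => t; rewrite /g1 /g2 /=; congr (_ *: (f _ - _)).
apply/rowP => j; case: (split_ordP j) => [j' ->|j' ->].
  by rewrite row_mxEl [RHS]mxE row_mxEl !mxE eq_lrshift andbF mulr0 add0r.
by rewrite row_mxEr [RHS]mxE row_mxEr !mxE eq_rshift.
Qed.

(** Supplies a frame over an arbitrary point. Smoothness in both directions is compatibility of
    charts composed with a translation. *)
Lemma local_diffeo0_chart n (M : manifoldType R n) (c : chart R n M) (x : M) :
  atlas M c -> chart_dom c x ->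
  local_diffeo0 (fun u => chart_inv c (u + c x) : M).
Proof.
move=> Ac cx; have [oc oi cK cc ci] := atlas_chart _ Ac.
pose U := [set u : 'rV[R]_n | (c @` chart_dom c) (u + c x)].
pose phi u := chart_inv c (u + c x) : M.
have tc (b : 'rV[R]_n) : continuous (fun u : 'rV[R]_n => u + b).
  by move=> u; apply: continuousD; [exact: cvg_id|exact: cst_continuous].
have oU : open U by apply: open_comp => // u _; exact: tc.
have Ud u : U u -> chart_dom c (phi u) /\ c (phi u) = u + c x.
  by move=> [y cy ey]; rewrite /phi -ey cK.
have phic u : U u -> {for u, continuous phi}.
  move=> Uu.
  have : {for u, continuous ((chart_inv c : _ -> M) \o (fun u => u + c x))}.
    by apply: continuous_comp; [exact: tc|exact: ci].
  by [].
have EU : phi @` U = chart_dom c.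
  rewrite eqEsubset; split=> [_ [u /Ud[cu _] <-]//|y cy].
  exists (c y - c x); first by exists y => //; rewrite subrK.
  by rewrite /phi subrK cK.
exists U, (fun y => c y - c x); rewrite -/phi EU; split=> //.
- by split=> //; exists x => //; rewrite add0r.
- by move=> u /Ud[_ ->]; rewrite addrK.
- split=> // _ d -> Ad.
  have [od _ dK _ _] := atlas_chart _ Ad.
  apply: (@Cinfty_on_sub _ _ _ (U `&` phi @^-1` chart_dom d)).
    by move=> _ [u [[Uu _] du] <-].
  have oO : open (U `&` phi @^-1` chart_dom d).
    exact: open_setI_preimage.
  apply: (Cinfty_on_comp (f := fun u => u + c x) (g := d \o chart_inv c) oO)
    (atlas_compatible _ _ Ac Ad).
  + by rewrite setIC; apply: chart_image_open => //; exact: atlas_chart.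
  + by move=> u [/Ud[cu eu] du]; exists (phi u).
  + exact: Cinfty_on_translate.
- split=> [y cy|d _ Ad ->].
    apply: continuousD; [exact: cc|exact: cst_continuous].
  have [od _ dK _ _] := atlas_chart _ Ad.
  have oO : open (d @` (chart_dom d `&` chart_dom c)).
    by rewrite setIC; apply: chart_image_open => //; exact: atlas_chart.
  apply: (@Cinfty_on_sub _ _ _ (d @` (chart_dom d `&` chart_dom c))).
    by move=> _ [y [[cy dy] _] <-]; exists y.
  apply: (Cinfty_on_comp (f := c \o chart_inv d) (g := fun v => v - c x) oO openT) => //.
    exact: atlas_compatible.
  by apply: Cinfty_on_translate; exact: openT.
Qed.
End SmoothTools.

(** * The action read in the coordinates given by a frame *)

Section FrameCoordinates.
Local Open Scope classical_set_scope.
Local Open Scope ring_scope.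
Local Notation e_ i := (delta_mx 0 i).
Context {R : realType} {m n : nat} {G : lieGroupType R m}
  {M : manifoldType R n} (a : smooth_action G M)
  (phi : 'rV[R]_n -> M) (U : set 'rV[R]_n) (psi : M -> 'rV[R]_n)
  (oU : open U) (U0 : U 0) (oI : open (phi @` U))
  (psiK : forall v, U v -> psi (phi v) = v)
  (sphi : smooth_on (euclid_atlas R n) (atlas M) U phi)
  (spsi : smooth_on (atlas M) (euclid_atlas R n) (phi @` U) psi).

(** The action of [h] in the coordinates of the frame. It is meaningful only for [u] in [U] with
    [a h (phi u)] in the image of [U], where [psi] inverts [phi]; the lemmas below keep track of
    both conditions. *)
Let F (h : G) (u : 'rV[R]_n) : 'rV[R]_n := psi (a h (phi u)).

Let act_continuous : continuous (fun gx : G * M => a gx.1 gx.2).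
Proof. by move=> gx; have [+ _] := act_smooth a; apply. Qed.

Let imK y : (phi @` U) y -> phi (psi y) = y.
Proof. by move=> [v Uv <-]; rewrite psiK. Qed.

(** Smoothness of the action is joint in the group element and the point. Here it is carried to the
    pair formed by the coordinates of [h] in [c] and the frame coordinates [u], on an open set [O]
    where [F] is meaningful. *)
Lemma frame_coord_Cinfty (h0 : G) (c : chart R m G) :
  atlas G c -> chart_dom c h0 -> (phi @` U) (a h0 (phi 0)) ->
  exists O : set 'rV[R]_(m + n),
  [/\ open O, O (row_mx (c h0) 0),
    forall h u, chart_dom c h -> O (row_mx (c h) u) ->
      U u /\ (phi @` U) (a h (phi u)) &
    Cinfty_on O (fun v => F (chart_inv c (lsubmx v)) (rsubmx v))].
Proof.
move=> Ac ch0 Uh0; have [cphi sphi'] := sphi.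
have [d Ad d0] := @atlas_cover R n M (phi 0).
have [ch1 ch2] := conj (atlas_chart _ Ac) (atlas_chart _ Ad).
have [oc _ cK _ _] := ch1; have [od _ dK _ _] := ch2.
have chp := is_chart_prod ch1 ch2; have [ocd _ _ _ _] := chp.
have prod_ch (e : chart R (m + n) (G * M)) :
    prod_atlas (atlas G) (atlas M) e -> is_chart e.
  by move=> [e1 A1 [e2 A2 <-]]; apply: is_chart_prod; exact: atlas_chart.
pose V := (fun gx : G * M => a gx.1 gx.2) @^-1` (phi @` U).
have oV : open V by apply: open_comp => // x _; exact: act_continuous.
have [_ /(_ (prod_chart c d) (Chart setT id id)) sF] :
    smooth_on (prod_atlas (atlas G) (atlas M)) (euclid_atlas R n) V
      (psi \o (fun gx : G * M => a gx.1 gx.2)).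
  apply: (smooth_on_comp prod_ch (@atlas_chart R n M) (@is_chart_euclid R n)
    (@atlas_cover R n M) oV oI _ _ spsi) => //.
  exact: smooth_on_sub (act_smooth a).
have {sF} := sF (ex_intro2 _ _ _ Ac (ex_intro2 _ _ _ Ad erefl)) erefl.
rewrite preimage_setT setIT => sF.
pose Q := prod_chart c d @` (V `&` chart_dom (prod_chart c d)).
have oQ : open Q by exact: chart_image_open.
(* [L] keeps the group coordinates and replaces the frame coordinates [u] by those of [phi u] in the
   chart [d], the ones used by the atlas of the product. *)
pose L (v : 'rV[R]_(m + n)) := row_mx (lsubmx v) (d (phi (rsubmx v))).
pose W := U `&` phi @^-1` chart_dom d.
have oW : open W by exact: open_setI_preimage.
pose O' := (@rsubmx R 1 m n) @^-1` W.
have oO' : open O' by apply: open_comp => // v _; exact: rsubmx_continuous.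
have sL : Cinfty_on O' L.
  have /Cinfty_onP sd : Cinfty_on W (d \o phi).
    apply: Cinfty_on_sub (sphi' _ _ erefl Ad) => v [Uv dv].
    by exists v.
  apply/Cinfty_onP => k; apply/Ck_on_rowP => // j.
  case: (split_ordP j) => [j' ->|j' ->].
    apply: (@Ck_on_ext _ _ _ k O' (fun v => v 0 (lshift n j'))) => //.
      by move=> v _; rewrite row_mxEl mxE.
    exact: Ck_on_coord.
  apply: (@Ck_on_ext _ _ _ k O' ((fun u => (d \o phi) u 0 j') \o rsubmx)) => //.
    by move=> v _; rewrite row_mxEr.
  apply: (Ck_on_comp1 oO' oW) => //; last first.
    by move: j'; apply/Ck_on_rowP.
  apply/Ck_on_rowP => // i.
  apply: (@Ck_on_ext _ _ _ k O' (fun v => v 0 (rshift m i))) => //.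
    by move=> v _; rewrite mxE.
  exact: Ck_on_coord.
pose O := O' `&` L @^-1` Q.
have oO : open O.
  by apply: open_setI_preimage => // v /(sL [::])[].
exists O; split=> //.
- split; first by rewrite /O' /= row_mxKr.
  exists (h0, phi 0); first by split.
  by rewrite /L row_mxKl row_mxKr.
- move=> h u ch []; rewrite /O' /L /= row_mxKl row_mxKr => -[Uu du].
  (* Injectivity of the charts [c] and [d] identifies [(h', x)] with [(h, phi u)]. *)
  move=> [[h' x] [Vx [/= ch' dx]] /eq_row_mx[eh ex]]; split=> //.
  move: Vx; rewrite /V /=.
  by rewrite -(cK h')// eh cK// -(dK x)// ex dK.
- apply: (@Cinfty_on_ext _ _ _ _ ((psi \o (fun gx : G * M => a gx.1 gx.2))
    \o chart_inv (prod_chart c d) \o L)) => //.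
    by move=> v [[Uv dv] _]; rewrite /F /L /= row_mxKl row_mxKr dK.
  apply: (Cinfty_on_comp oO oQ _ _ sF); first by move=> v [].
  by apply: Cinfty_on_sub sL => v [].
Qed.

(** The partial derivatives in [u] are continuous in [(h, u)] jointly and are those of the identity
    at [(h0, 0)]. A neighbourhood in both variables is the form that compactness of the stabiliser
    can make uniform in [h]. *)
Lemma frame_coord_near (h0 : G) (e : R) : 0 < e -> (phi @` U) (a h0 (phi 0)) ->
  (forall i j, 'D_(e_ i) (fun v => F h0 v 0 j) 0 = (e_ i : 'rV[R]_n) 0 j) ->
  \forall h \near h0 & u \near (0 : 'rV[R]_n),
    [/\ U u, (phi @` U) (a h (phi u)),
      forall j, differentiable (fun v => F h v 0 j) u &
      forall i j, `|'D_(e_ i) (fun v => F h v 0 j) u - (e_ i : 'rV[R]_n) 0 j| <= e].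
Proof.
move=> e0 Uh0 D0.
have [c Ac ch0] := @atlas_cover R m G h0.
have [oc _ cK cc _] := atlas_chart _ Ac.
have [V [oV V0 VU sV]] := frame_coord_Cinfty Ac ch0 Uh0.
pose f v := F (chart_inv c (lsubmx v)) (rsubmx v).
have fE h : chart_dom c h -> F h = fun u => f (row_mx (c h) u).
  by move=> ch; apply/funext => u; rewrite /f row_mxKl row_mxKr cK.
have fCk k j : Ck_on k V (fun v => f v 0 j).
  by move: j; apply/Ck_on_rowP => //; move/Cinfty_onP: sV; apply.
have near_f : \forall v \near row_mx (c h0) (0 : 'rV[R]_n), V v /\
    forall i j, `|'D_(e_ (rshift m i)) (fun v => f v 0 j) v
                   - (e_ i : 'rV[R]_n) 0 j| <= e.
  apply: filterI; first exact: open_nbhs_nbhs (conj oV V0).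
  apply: (@filter_forall _ _ _ (nbhs (row_mx (c h0) (0 : 'rV[R]_n))) _ _) => i.
  apply: (@filter_forall _ _ _ (nbhs (row_mx (c h0) (0 : 'rV[R]_n))) _ _) => j.
  have [_ /(_ (rshift m i))[_ dfj]] := fCk 1 j.
  have /cvgrPdist_le/(_ e e0) := Ck_cont (k := 0) dfj V0; apply: filterS => v.
  by rewrite -derive_row_mx -D0 (fE h0)// distrC.
have cm : {for (h0, 0 : 'rV[R]_n), continuous (fun p : G * 'rV[R]_n => row_mx (c p.1) p.2)}.
  apply: (@continuous_comp _ _ _ (fun p : G * 'rV[R]_n => (c p.1, p.2))
    (fun p : 'rV[R]_m * 'rV[R]_n => row_mx p.1 p.2)); last exact: row_mx_continuous.
  apply: continuous_pair; last exact: cvg_snd.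
  by apply: (@continuous_comp _ _ _ fst c); [exact: cvg_fst|exact: cc].
have near_c : \forall h \near h0 & u \near (0 : 'rV[R]_n), chart_dom c h.
  exists (chart_dom c, setT) => [|[h u] []//]; split; last exact: filterT.
  exact: open_nbhs_nbhs (conj oc ch0).
apply: filterS2 near_c (cm _ near_f) => -[h u] /= ch [Vhu Dhu].
have [Uu Ihu] := VU _ _ ch Vhu; split=> // [j|i j]; rewrite fE//; last first.
  by rewrite (derive_row_mx (fun v => f v 0 j)).
pose Vh := row_mx (c h) @^-1` V.
have oVh : open Vh.
  apply: open_comp => // v _.
  apply: (@continuous_comp _ _ _ (fun v : 'rV[R]_n => (c h, v))
    (fun p : 'rV[R]_m * 'rV[R]_n => row_mx p.1 p.2)); last exact: row_mx_continuous.
  by apply: continuous_pair; [exact: cst_continuous|exact: cvg_id].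
apply: (@Ck_on_differentiable _ _ 0 Vh) => //.
apply: (Ck_on_comp1 (f := row_mx (c h)) (g := fun v => f v 0 j) oVh oV) => //.
by have /Cinfty_onP := Cinfty_on_row_mx (c h) oVh; apply.
Qed.

(** Composing [a h \o phi] and [phi], which have the same 1-jet since [1 <= l], with [psi] gives
    [F h] and the identity near [0]; the chain rule makes their first derivatives at [0] agree. *)
Lemma frame_coord_derive (h : G) (l : nat) : (1 <= l)%N ->
  same_jet l (a h \o phi) phi ->
  forall i j, 'D_(e_ i) (fun v => F h v 0 j) 0 = (e_ i : 'rV[R]_n) 0 j.
Proof.
move=> l1 [/= h0 jets] i j.
have [c Ac c0] := @atlas_cover R n M (phi 0).
have ch := atlas_chart _ Ac; have [oc _ cK _ _] := ch.
have shphi : smooth_on (euclid_atlas R n) (atlas M) U (a h \o phi).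
  exact: (smooth_on_comp (@is_chart_euclid R n) (@atlas_chart R n M)
    (@atlas_chart R n M) (@atlas_cover R n M) oU openT _ sphi (act_smooth1 a h)).
pose T := phi @` U `&` chart_dom c.
have oT : open T by exact: openI.
pose W := (U `&` phi @^-1` T) `&` (U `&` (a h \o phi) @^-1` T).
have oW : open W.
  by apply: openI; apply: open_setI_preimage => //; [exact: sphi.1|exact: shphi.1].
have T0 : T (phi 0) by split=> //; exists 0.
have W0 : W 0 by split; split=> //=; rewrite h0.
have oQ : open (c @` T) by exact: chart_image_open.
have cW f : smooth_on (euclid_atlas R n) (atlas M) U f ->
    W `<=` U `&` f @^-1` T -> Cinfty_on W (c \o f).
  move=> [_ sf] Wf; apply: Cinfty_on_sub (sf _ _ erefl Ac) => v /Wf[Uv [_ cv]].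
  by exists v.
have sg : Cinfty_on (c @` T) (psi \o chart_inv c).
  apply: Cinfty_on_sub (spsi.2 _ _ Ac erefl) => _ [x [Ix cx] <-].
  by exists x.
have W1 : W `<=` U `&` phi @^-1` T by move=> v [].
have W2 : W `<=` U `&` (a h \o phi) @^-1` T by move=> v [].
have mapT f : W `<=` U `&` f @^-1` T -> forall v, W v -> (c @` T) ((c \o f) v).
  by move=> Wf v /Wf[_ Tv]; exists (f v).
(* The chain rule for jets, at order 1, with [psi] read in the chart [c] as outer map. *)
have /eq_jetP/(eq_jet_ext oW W0) E := pderiv_comp oW oQ W0 (mapT _ W2) (mapT _ W1)
  (cW _ shphi W2) (cW _ sphi W1) sg
  (fun w (w1 : (size w <= 1)%N) =>
    jets c Ac (eq_ind_r (chart_dom c) c0 h0) w (leq_trans w1 l1)).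
have FE v : W v -> ((psi \o chart_inv c) \o (c \o (a h \o phi))) v = F h v.
  by move=> /W2[_ [_ cv]]; rewrite /= cK.
have idE v : W v -> ((psi \o chart_inv c) \o (c \o phi)) v = id v.
  by move=> /W1[Uv [_ cv]]; rewrite /= cK// psiK.
have [_ /(_ i)[DE _]] := E _ _ FE idE.
have /Cinfty_onP/(_ 1)[_ /(_ i)[/(_ _ W0) dF _]] : Cinfty_on W (F h).
  apply: Cinfty_on_ext FE _ => //.
  exact: Cinfty_on_comp oW oQ (mapT _ W2) (cW _ shphi W2) sg.
by move: DE; rewrite derive_id derive_mx// => /rowP/(_ j); rewrite mxE.
Qed.

Lemma act_id_near (K : set G) (g : G) (l : nat) : (1 <= l)%N -> compact K ->
  (forall k, K (g ^+ k)%g) -> (forall h, K h -> same_jet l (a h \o phi) phi) ->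
  \forall x \near phi 0, a g x = x.
Proof.
move=> l1 /compact_near_coveringP cK Kg Kjet.
have I0 : (phi @` U) (phi 0) by exists 0.
have fix0 h : K h -> a h (phi 0) = phi 0 by move=> /Kjet[].
(* Chosen to make the Lipschitz constant [n e] at most 1/2; [n.+1] keeps [e] positive in dimension
   0. *)
pose e : R := (2 * n.+1%:R)^-1.
have e0 : 0 < e by rewrite invr_gt0 mulr_gt0// ltr0n.
have ne : n%:R * e <= 2^-1.
  rewrite /e invfM mulrCA ler_piMr ?invr_ge0//.
  by rewrite ler_pdivrMr ?ltr0n// mul1r ler_nat.
pose P (u : 'rV[R]_n) (h : G) := [/\ U u, (phi @` U) (a h (phi u)),
  forall j, differentiable (fun v => F h v 0 j) u &
  forall i j, `|'D_(e_ i) (fun v => F h v 0 j) u - (e_ i : 'rV[R]_n) 0 j| <= e].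
have : \forall u \near (0 : 'rV[R]_n), K `<=` P u.
  apply: (cK _ (nbhs (0 : 'rV[R]_n)) P) => h Kh; apply: frame_coord_near => //; first by rewrite fix0.
  exact: frame_coord_derive (Kjet h Kh).
move=> /nbhs_ballP[r /= r0 Hr].
(* Second use of compactness: for [u] close to [0], all points [F h u] with [h] in [K] lie in the
   ball where the estimates hold. This bounds the sequence of [F (g ^+ k) u] and allows [F g u] as
   an argument. *)
have small : \forall u \near (0 : 'rV[R]_n), K `<=` (fun h => `|F h u| < r).
  apply: (cK _ (nbhs (0 : 'rV[R]_n)) (fun u h => `|F h u| < r)) => h Kh.
  have cF : {for (h, 0 : 'rV[R]_n), continuous (fun p : G * 'rV[R]_n => F p.1 p.2)}.
    apply: (@continuous_comp _ _ _ (fun p : G * 'rV[R]_n => a p.1 (phi p.2)) psi); last first.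
      by apply: spsi.1; rewrite /= fix0.
    apply: (@continuous_comp _ _ _ (fun p : G * 'rV[R]_n => (p.1, phi p.2))
      (fun gx : G * M => a gx.1 gx.2)); last exact: act_continuous.
    apply: continuous_pair; first exact: cvg_fst.
    by apply: (@continuous_comp _ _ _ snd phi); [exact: cvg_snd|exact: sphi.1].
  have F0 : F h 0 = 0 by rewrite /F fix0// psiK.
  have /cvgrPdist_lt/(_ r r0) [[A B] /= [hA B0] AB] := cF.
  exists (A, B) => // -[h' u] /= ABhu.
  by have := AB (h', u) ABhu; rewrite /= F0 sub0r normrN.
have fix_u : \forall u \near (0 : 'rV[R]_n), a g (phi u) = phi u.
  near=> u.
  have ur : `|u| < r by rewrite -norm_ball0; near: u; exact: nbhsx_ballx.
  have Fr h : K h -> `|F h u| < r by move: h; near: u; exact: small.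
  have inB v : `|v| < r -> ball (0 : 'rV[R]_n) r v by rewrite norm_ball0.
  have [Uu Igu _ _] := Hr _ (inB _ ur) _ (Kg 1%N).
  rewrite expg1 in Igu.
  suff /eqP : F g u - u = 0.
    by rewrite subr_eq0 => /eqP e'; rewrite -[LHS]imK// -/(F g u) e'.
  apply: (@bounded_drift _ _ (fun k => F (g ^+ k)%g u) _ r) => k; last first.
    by apply: ltW; exact: Fr.
  (* The increment becomes a difference of values of the single map [F (g ^+ k)] at [F g u] and [u],
     to which the Lipschitz estimate applies. *)
  have -> : F (g ^+ k.+1)%g u = F (g ^+ k)%g (F g u).
    by rewrite /F imK// -actM -expgSr.
  apply: le_trans (ler_wpM2r _ ne) => //.
  apply: (@near_id_lipschitz _ _ _ r) => //.
  - exact: ltW.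
  - by move=> v j /inB/Hr/(_ _ (Kg k))[].
  - by move=> v i j /inB/Hr/(_ _ (Kg k))[].
  - by apply: Fr; rewrite -[g]expg1.
(* Continuity of [psi] carries the conclusion from [u] near [0] to points near [phi 0]. *)
have near_psi : \forall x \near phi 0, a g (phi (psi x)) = phi (psi x).
  have := spsi.1 _ I0; rewrite /prop_for /continuous_at psiK// => cpsi.
  exact: (cpsi _ fix_u).
apply: filterS2 near_psi (open_nbhs_nbhs (conj oI I0)) => x + Ix.
by rewrite imK.
Unshelve. all: by end_near. Qed.

End FrameCoordinates.

(** * Stabilisers of jets, and the interior of the fixed point set *)

Section FixedJets.
Local Open Scope classical_set_scope.
Local Open Scope ring_scope.
Context {R : realType} {m n : nat} {G : lieGroupType R m}
  {M : manifoldType R n} (a : smooth_action G M) (l : nat).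

Lemma frame_actE g (phi : local_frame M) : frame_act a g phi = a g \o phi :> (_ -> _).
Proof. by case: phi. Qed.

Lemma jet_eqP (phi chi : local_frame M) :
  jet l phi = jet l chi <-> same_jet l phi chi.
Proof. by split=> [/eqmodP/asboolP//|?]; apply/eqmodP/asboolP. Qed.

Lemma prolong_jetP g (phi : local_frame M) :
  prolong a l g (jet l phi) = jet l phi <-> same_jet l (a g \o phi) phi.
Proof. by rewrite prolongE jet_eqP frame_actE. Qed.

Lemma prolong1 j : prolong a l 1%g j = j.
Proof.
rewrite -[j]reprK; apply/prolong_jetP.
have -> : a 1%g \o frame_repr j = frame_repr j by apply/funext => u /=; rewrite act1.
by [].
Qed.

Lemma prolongM g h j : prolong a l (g * h)%g j = prolong a l g (prolong a l h j).
Proof.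
rewrite -[j]reprK -/(jet l _) !prolongE; apply/jet_eqP; rewrite !frame_actE.
set f := a (g * h)%g \o _; set f' := a g \o _.
by have -> : f = f' by apply/funext => u; rewrite /f /f' /= actM.
Qed.

Lemma fixed_jet_near g (phi : local_frame M) : (1 <= l)%N ->
  proper_action (prolong a l) -> same_jet l (a g \o phi) phi ->
  \forall x \near phi 0, a g x = x.
Proof.
move=> l1 [_ proper] gphi; set j := jet l phi.
have [U [psi [[oU U0] oI psiK sphi spsi]]] : local_diffeo0 phi by case: phi {gphi j}.
pose K := [set h | prolong a l h j = j].
have cK : compact K.
  (* The stabiliser is the projection to [G] of the preimage of the one-point set [(j, j)] under the
     proper map. *)
  have -> : K = fst @` ((fun gx => (prolong a l gx.1 gx.2, gx.2)) @^-1` [set (j, j)]).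
    rewrite eqEsubset; split=> [h Kh|_ [[h x] /= [+ ex] <-]]; last by rewrite ex.
    by exists (h, j) => //=; rewrite /K/= in Kh *; rewrite Kh.
  apply: continuous_compact; last exact/proper/compact_set1.
  by apply: continuous_subspaceT => x; exact: cvg_fst.
have Kg : K g by apply/prolong_jetP.
apply: (act_id_near oU U0 oI psiK sphi spsi l1 cK) => [k|h /prolong_jetP//].
elim: k => [|k IH]; first by rewrite /K/= expg0 prolong1.
by rewrite /K/= expgS prolongM IH.
Qed.

(** On the open set [S] the maps [a g] and [id] agree, hence so do all derivatives of their
    composites with [phi]; continuity extends these equalities to the closure of [S]. *)
Lemma closure_fixed_jet g (phi : local_frame M) :
  closure [set x | a g x = x]° (phi 0) -> same_jet l (a g \o phi) phi.
Proof.
set S := _° => Sphi.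
have oS : open S by exact: open_interior.
have fixS x : S x -> a g x = x by move/interior_subset.
have [U [psi [[oU U0] oI psiK sphi spsi]]] : local_diffeo0 phi by case: phi {Sphi}.
have sgphi : smooth_on (euclid_atlas R n) (atlas M) U (a g \o phi).
  exact: (smooth_on_comp (@is_chart_euclid R n) (@atlas_chart R n M)
    (@atlas_chart R n M) (@atlas_cover R n M) oU openT _ sphi (act_smooth1 a g)).
(* In a Hausdorff space it suffices that all neighbourhoods of the two points meet; a point of [S]
   near [phi 0], fixed by [g], lies in both. *)
have fix0 : a g (phi 0) = phi 0.
  apply: (@manifold_hausdorff R n M) => A B Ag B0.
  have Ag' : nbhs (phi 0) (a g @^-1` A) by exact: act_continuous1.
  have [y [Sy [Agy By]]] := Sphi _ (filterI Ag' B0).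
  by exists y; split=> //; rewrite -(fixS _ Sy).
split=> // c Ac cg w _; have [oc _ _ _ _] := atlas_chart _ Ac.
pose W := (U `&` phi @^-1` chart_dom c) `&` (U `&` (a g \o phi) @^-1` chart_dom c).
have W0 : W 0 by split; split=> //=; rewrite -fix0.
have cW f : smooth_on (euclid_atlas R n) (atlas M) U f ->
    W `<=` U `&` f @^-1` chart_dom c -> Cinfty_on W (c \o f).
  move=> [_ sf] Wf; apply: Cinfty_on_sub (sf _ _ erefl Ac) => v /Wf[Uv cv].
  by exists v.
have [c1 _] := cW _ sgphi (fun v => @proj2 _ _) w _ W0.
have [c2 _] := cW _ sphi (fun v => @proj1 _ _) w _ W0.
(* If the two derivatives differed at [0], they would differ nearby, in particular at some [u] with
   [phi u] in [S]. *)
apply/eqP/negPn/negP; rewrite -subr_eq0 => ne.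
have I0 : (phi @` U) (phi 0) by exists 0.
have := spsi.1 _ I0; rewrite /prop_for /continuous_at psiK// => cpsi.
have near_ne : \forall y \near phi 0,
    pderiv (c \o (a g \o phi)) w (psi y) - pderiv (c \o phi) w (psi y) != 0.
  exact: (cpsi _ (cvgr_neq0 _ (continuousB c1 c2) ne)).
have [y [Sy [Iy]]] := Sphi _ (filterI (open_nbhs_nbhs (conj oI I0)) near_ne).
have [u Uu ey] := Iy; rewrite -{}ey in Sy *; rewrite /= psiK// => /eqP; apply.
apply/eqP; rewrite subr_eq0; apply/eqP.
have /eq_jetP := @eq_jet_open _ _ _ (size w) (U `&` phi @^-1` S) u
  (c \o (a g \o phi)) (c \o phi) (open_setI_preimage oU oS sphi.1) (conj Uu Sy)
  (fun v Uv => congr1 c (fixS _ Uv.2)).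
exact.
Qed.

(** A frame over a point of the closure has its [l]-jet fixed by [g], so properness makes [g] the
    identity near that point. *)
Lemma interior_fixed_closed g : (1 <= l)%N -> proper_action (prolong a l) ->
  closed [set x | a g x = x]°.
Proof.
move=> l1 proper x Sx.
have [c Ac cx] := @atlas_cover R n M x; have [_ _ cK _ _] := atlas_chart _ Ac.
pose phi := LocalFrame (local_diffeo0_chart Ac cx).
have phi0 : phi 0 = x by rewrite /= add0r cK.
rewrite -phi0; apply: (@fixed_jet_near g phi) => //.
by apply: closure_fixed_jet; rewrite phi0.
Qed.

(** The interior of the fixed point set is open, closed and contains [phi 0], so it contains the
    whole component. *)
Lemma fixed_jet_component g (phi : local_frame M) : (1 <= l)%N ->
  proper_action (prolong a l) -> same_jet l (a g \o phi) phi ->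
  connected_component setT (phi 0) `<=` [set x | a g x = x].
Proof.
move=> l1 proper gphi; set C := connected_component _ _; set S := [set x | _].
have phiS : S° (phi 0) by exact: fixed_jet_near gphi.
suff CS : C `&` S° = C by rewrite -CS => x [_ /interior_subset].
apply: (component_connected (A := setT)).
- by exists (phi 0); split=> //; exact: connected_component_refl.
- by exists S° => //; exact: open_interior.
- by exists S° => //; exact: interior_fixed_closed.
Qed.
End FixedJets.

Theorem corollary5p5 (R : realType) (m n : nat) (G : lieGroupType R m)
    (M : manifoldType R n) (a : smooth_action G M)
    (Heff : component_effective a)
    (l : nat) (Hl : (1 <= l)%N)
    (Hproper : proper_action (prolong a l)) :
  free_action (prolong a l).
Proof.
move=> g j gj; apply: contrapT => g1.
(* Effectiveness is used on the component of the base point of the fixed jet. *)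
have [x Cx] := Heff g g1 (frame_repr j 0%R); apply.
apply: (fixed_jet_component Hl Hproper _ Cx).
by apply/prolong_jetP; rewrite /jet reprK.
Qed.
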